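(* Let $X$ be a Banach space with the uniform primary factorisation property (UPFP). Suppose that at least one of the following holds: (i) $X$ is isomorphic to $\ell_p(X)$ for some $1\le p<\infty$; (ii) $X$ has finite cotype. Then both $c_0(X)$ and $\ell_\infty(X)$ have the UPFP. In particular, $c_0(X)$ and $\ell_\infty(X)$ are primary.
   Context: The scalar field is $\mathbb{R}$ or $\mathbb{C}$; operators are bounded linear maps; isomorphic means linearly homeomorphic. For a Banach space $X$, $\ell_p(X)$ ($1\le p\le\infty$) and $c_0(X)$ are the spaces of sequences $(x_n)_{n\in\mathbb{N}}$ in $X$ with $(\|x_n\|)_n\in\ell_p$, respectively $(\|x_n\|)_n\in c_0$, normed by $\|(\|x_n\|)_n\|_{\ell_p}$, respectively $\sup_n\|x_n\|$. For $C\ge1$, an operator $S\colon Z\to W$ factors through an operator $T\colon X\to Y$ with constant $C$ if there are operators $V\colon Z\to X$, $U\colon Y\to W$ with $UTV=S$ and $\|U\|\|V\|\le C$. A Banach space $X$ has the $C$-primary factorisation property ($C$-PFP) if for every operator $T\colon X\to X$ the identity $I_X$ factors through either $T$ or $I_X-T$ with constant $C$; $X$ has the uniform primary factorisation property (UPFP) if it has the $C$-PFP for some $C\ge1$. $X$ is primary if for every bounded projection $P\colon X\to X$ at least one of $PX$ and $(I_X-P)X$ is isomorphic to $X$. Finite cotype means cotype $q$ for some $q<\infty$. *)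

(* Defs.v *)
From HB Require Import structures.
From mathcomp Require Import all_boot all_order all_algebra.
From mathcomp Require Import all_classical all_reals all_analysis.
From mathcomp.real_closed Require Import complex.

Set Implicit Arguments.
Unset Strict Implicit.
Unset Printing Implicit Defensive.

Import Order.TTheory GRing.Theory Num.Theory.
Import numFieldNormedType.Exports.

Local Open Scope classical_set_scope.
Local Open Scope ring_scope.

Variant scalars := RealScalars | ComplexScalars.

Definition scalar_field (R : realType) (s : scalars) : numFieldType :=
  match s with RealScalars => R | ComplexScalars => R[i] end.

Definition of_real (R : realType) (s : scalars) : R -> scalar_field R s :=
  match s return R -> scalar_field R s with
  | RealScalars => fun a => a
  | ComplexScalars => fun a => real_complex R a
  end.

Definition to_real (R : realType) (s : scalars) : scalar_field R s -> R :=
  match s return scalar_field R s -> R with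
  | RealScalars => fun a => a
  | ComplexScalars => @complex.Re R
  end.

(* In a normed module over K the norm takes its values in K; [rnorm] is the
   same norm as an element of R. *)
Definition rnorm (R : realType) (s : scalars)
  (X : normedModType (scalar_field R s)) (x : X) : R := to_real `|x|.

Section rnorm_theory.
Context {R : realType} {s : scalars}.
Local Notation K := (scalar_field R s).

Lemma of_realK : cancel (@of_real R s) (@to_real R s).
Proof. by case: s. Qed.

Lemma of_realD (a b : R) : of_real s (a + b) = of_real s a + of_real s b.
Proof. by case: s => //=; rewrite rmorphD. Qed.

Lemma of_realM (a b : R) : of_real s (a * b) = of_real s a * of_real s b.
Proof. by case: s => //=; rewrite rmorphM. Qed.

Lemma of_real0 : of_real s 0 = 0 :> K.
Proof. by case: s => //=; rewrite rmorph0. Qed.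

Lemma of_real1 : of_real s 1 = 1 :> K.
Proof. by case: s => //=; rewrite rmorph1. Qed.

Lemma ler_of_real (a b : R) : (of_real s a <= of_real s b) = (a <= b).
Proof. by case: s => //=; rewrite lecR. Qed.

Lemma ltr_of_real (a b : R) : (of_real s a < of_real s b) = (a < b).
Proof. by case: s => //=; rewrite ltcR. Qed.

Lemma to_realK (a : K) : 0 <= a -> of_real s (to_real a) = a.
Proof.
case: s a => //= -[a b]; rewrite lecE/= => /andP[/eqP -> _].
by rewrite complexr0.
Qed.

Variable X : normedModType K.
Implicit Types x y : X.

Lemma rnormE x : of_real s (rnorm x) = `|x|.
Proof. by rewrite /rnorm to_realK. Qed.

Lemma rnorm_ge0 x : 0 <= rnorm x.
Proof. by rewrite -ler_of_real rnormE of_real0. Qed.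

Lemma ler_rnormD x y : rnorm (x + y) <= rnorm x + rnorm y.
Proof. by rewrite -ler_of_real of_realD !rnormE ler_normD. Qed.

Lemma rnormZ (a : K) x : rnorm (a *: x) = to_real `|a| * rnorm x.
Proof.
apply: (can_inj of_realK).
by rewrite of_realM !rnormE to_realK ?normrZ.
Qed.

Lemma rnorm0 : rnorm (0 : X) = 0.
Proof. by apply: (can_inj of_realK); rewrite rnormE normr0 of_real0. Qed.

Lemma rnorm0_eq0 x : rnorm x = 0 -> x = 0.
Proof. by move=> x0; apply/normr0_eq0; rewrite -rnormE x0 of_real0. Qed.

Lemma rnormN x : rnorm (- x) = rnorm x.
Proof. by rewrite /rnorm normrN. Qed.

End rnorm_theory.

(* Used for [1 <= p] only; the last branch is meant for [p = +oo]. *)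
Definition lnorm (R : realType) (p : \bar R) (a : nat -> R) : \bar R :=
  match p with
  | r%:E => ((\sum_(k <oo) (`|a k| `^ r)%:E) `^ r^-1)%E
  | _ => ereal_sup (range (fun k => `|a k|%:E))
  end.

Section lnorm_theory.
Context {R : realType} (p : \bar R) (p1 : (1 <= p)%E).
Implicit Types a b : nat -> R.

Let r_gt0 (r : R) : (1 <= r%:E)%E -> 0 < r.
Proof. by rewrite lee_fin; apply: lt_le_trans. Qed.

Lemma lnormE (r : R) a : (1 <= r%:E)%E ->
  lnorm r%:E a = 'N[@counting nat R]_r%:E [EFin \o a]%E.
Proof.
move=> /r_gt0 r0; rewrite Lnorm_counting//=; congr (_ `^ _)%E.
Qed.

Lemma lnorm_ge0 a : (0 <= lnorm p a)%E.
Proof.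
case: p => [r||]/=; first exact: poweR_ge0.
  by apply: le_ereal_sup_tmp; exists `|a 0%N|%:E; [exists 0%N|rewrite lee_fin].
by apply: le_ereal_sup_tmp; exists `|a 0%N|%:E; [exists 0%N|rewrite lee_fin].
Qed.

Lemma lnormD a b : (lnorm p (fun k => (a k + b k)%R) <= lnorm p a + lnorm p b)%E.
Proof.
case: p p1 => [r r1||//] /=.
  rewrite -!/(lnorm r%:E _) !lnormE//.
  exact: (@minkowski_EFin _ _ _ counting a b).
move=> _; apply: ge_ereal_sup => _ [k _ <-].
apply: (@le_trans _ _ (`|a k|%:E + `|b k|%:E)%E).
  by rewrite -EFinD lee_fin ler_normD.
by apply: leeD; apply: ereal_sup_ubound; exists k.
Qed.

Lemma le_lnorm a b : (forall k, `|a k| <= `|b k|) -> (lnorm p a <= lnorm p b)%E.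
Proof.
move=> ab; case: p p1 => [r r1||//] /=.
  apply: gt0_ler_poweR; rewrite ?invr_ge0 ?(ltW (r_gt0 _))//.
  - by rewrite in_itv/= leey andbT nneseries_ge0// => k _ _; rewrite lee_fin powR_ge0.
  - by rewrite in_itv/= leey andbT nneseries_ge0// => k _ _; rewrite lee_fin powR_ge0.
  - apply: lee_nneseries => k _; first by move=> _; rewrite lee_fin powR_ge0.
    by rewrite lee_fin ge0_ler_powR ?nnegrE// ltW// r_gt0.
move=> _; apply: ge_ereal_sup => _ [k _ <-].
apply: (@le_trans _ _ `|b k|%:E); first by rewrite lee_fin.
by apply: ereal_sup_ubound; exists k.
Qed.

Lemma lnormZ_le (c : R) a : 0 <= c ->
  (lnorm p (fun k => (c * a k)%R) <= c%:E * lnorm p a)%E.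
Proof.
move=> c0; case: p p1 => [r r1||//] /=.
  have r0 := r_gt0 r1.
  under eq_eseriesr do rewrite normrM powRM// EFinM ger0_norm//.
  rewrite nneseriesZl; last by move=> k _; rewrite lee_fin powR_ge0.
  rewrite poweRM ?invr_ge0 ?(ltW r0)//; last 2 first.
  - by rewrite lee_fin powR_ge0.
  - by rewrite nneseries_ge0// => k _ _; rewrite lee_fin powR_ge0.
  by rewrite poweR_EFin -powRrM mulfV ?gt_eqF// powRr1.
move=> _; apply: ge_ereal_sup => _ [k _ <-].
rewrite normrM ger0_norm// EFinM lee_pmul// ?lee_fin//.
by apply: ereal_sup_ubound; exists k.
Qed.

Lemma lnorm_coord a k : (`|a k|%:E <= lnorm p a)%E.
Proof.
case: p p1 => [r r1||//] /=; last by move=> _; apply: ereal_sup_ubound; exists k.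
have r0 := r_gt0 r1.
have {1}-> : `|a k|%:E = ((`|a k| `^ r)%:E `^ r^-1)%E.
  by rewrite poweR_EFin -powRrM mulfV ?gt_eqF// powRr1.
apply: gt0_ler_poweR; rewrite ?invr_ge0 ?(ltW r0)//.
- by rewrite in_itv/= leey andbT lee_fin powR_ge0.
- by rewrite in_itv/= leey andbT nneseries_ge0// => j _ _; rewrite lee_fin powR_ge0.
rewrite (@nneseriesD1 _ _ k xpredT)//.
by apply: leeDl; rewrite nneseries_ge0// => j _ _; rewrite lee_fin powR_ge0.
Qed.

Lemma lnorm0 : lnorm p (fun=> 0) = 0%E.
Proof.
apply/eqP; rewrite eq_le lnorm_ge0 andbT.
have := lnormZ_le (fun=> 0) (lexx 0); rewrite mul0e.
by under eq_fun do rewrite mul0r.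
Qed.

Definition trunc (m : nat) a k : R := if (k < m)%N then a k else 0.

Lemma lnorm_trunc a (M : R) :
  (forall m, lnorm p (trunc m a) <= M%:E)%E -> (lnorm p a <= M%:E)%E.
Proof.
move=> aM; have M0 : 0 <= M.
  by rewrite -lee_fin; apply: le_trans (aM 0%N); exact: lnorm_ge0.
case: p p1 aM => [r r1 /= aM|_ /= aM|//]; last first.
  apply: ge_ereal_sup => _ [k _ <-]; apply: le_trans (aM k.+1).
  by apply: ereal_sup_ubound; exists k => //; rewrite /trunc ltnSn.
have r0 := r_gt0 r1.
have -> : M%:E = ((M `^ r)%:E `^ r^-1)%E.
  by rewrite poweR_EFin -powRrM mulfV ?gt_eqF// powRr1.
apply: gt0_ler_poweR; rewrite ?invr_ge0 ?(ltW r0)//.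
- by rewrite in_itv/= leey andbT nneseries_ge0// => j _ _; rewrite lee_fin powR_ge0.
- by rewrite in_itv/= leey andbT lee_fin powR_ge0.
apply: lime_le; first by apply: is_cvg_nneseries => j _ _; rewrite lee_fin powR_ge0.
apply: nearW => m.
have := aM m; set S := (\sum_(k <oo) _)%E => SM.
have S0 : (0 <= S)%E by rewrite nneseries_ge0// => j _ _; rewrite lee_fin powR_ge0.
have : (S <= (M `^ r)%:E)%E.
  have -> : S = ((S `^ r^-1) `^ r)%E.
    by rewrite -poweRrM mulVf ?gt_eqF// poweRe1.
  rewrite -poweR_EFin; apply: gt0_ler_poweR => //; first exact: ltW.
  - by rewrite in_itv/= leey andbT poweR_ge0.
  - by rewrite in_itv/= leey andbT lee_fin.
apply: le_trans; rewrite /S (nneseries_split 0 m); last first.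
  by move=> j _; rewrite lee_fin powR_ge0.
rewrite add0n -[leLHS]adde0; apply: leeD; last first.
  by rewrite nneseries_ge0// => j _ _; rewrite lee_fin powR_ge0.
rewrite !big_mkord; apply: lee_sum => j _.
by rewrite /trunc ltn_ord.
Qed.

Lemma lnorm_trunc_lty (c : R) m : (lnorm p (trunc m (fun=> c)) < +oo)%E.
Proof.
elim: m => [|m IH]; first by rewrite (_ : trunc _ _ = fun=> 0) ?lnorm0.
rewrite (_ : trunc _ _ = fun k => trunc m (fun=> c) k + (if k == m then c else 0)).
  apply: le_lt_trans (lnormD _ _) _; rewrite lte_add_pinfty//.
  case: p p1 => [r r1||//] /=; last first.
    move=> _; apply: (@le_lt_trans _ _ `|c|%:E); last by rewrite ltry.
    by apply: ge_ereal_sup => _ [k _ <-]; case: eqP; rewrite lee_fin// normr0.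
  have r0 := r_gt0 r1.
  apply: poweR_lty; rewrite (@nneseriesD1 _ _ m xpredT)//.
  rewrite eqxx eseries0 ?adde0 ?ltry// => j _ /= /negPf ->.
  by rewrite normr0 powR0 ?gt_eqF.
apply/funext => k; rewrite /trunc ltnS leq_eqVlt.
by case: eqVneq => [->|]/=; rewrite ?ltnn ?add0r ?addr0.
Qed.

End lnorm_theory.

Section ell.
Context {R : realType} {s : scalars} (p : \bar R) (p1 : (1 <= p)%E).
Local Notation K := (scalar_field R s).
Variable X : normedModType K.

(* [hp] does not occur in the body: it lets the closure instance below, which
   depends on [1 <= p], be keyed on [ell_pred p1]. *)
Definition ell_pred (hp : (1 <= p)%E) : {pred nat -> X} :=
  mem [set x | (lnorm p (fun k => rnorm (x k)) < +oo)%E].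

Lemma ell_submod_closed : submod_closed (ell_pred p1).
Proof.
split=> [|a x y]; rewrite !inE/=.
  rewrite (_ : (fun k => _) = fun=> 0) ?lnorm0//.
  by apply/funext => k; exact: rnorm0.
move=> xoo yoo.
apply: (@le_lt_trans _ _
   (lnorm p (fun k => to_real `|a| * rnorm (x k) + rnorm (y k)))%R).
  apply: le_lnorm => // k.
  have a0 : 0 <= to_real `|a| * rnorm (x k) by rewrite -rnormZ rnorm_ge0.
  rewrite [leLHS]ger0_norm ?rnorm_ge0// [leRHS]ger0_norm ?addr_ge0 ?rnorm_ge0//.
  by apply: le_trans (ler_rnormD _ _) _; rewrite rnormZ.
apply: le_lt_trans (lnormD p1 _ _) _; rewrite lte_add_pinfty//.
have a0 : 0 <= to_real `|a| by rewrite -(@ler_of_real R s) of_real0 to_realK.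
apply: le_lt_trans (lnormZ_le p1 _ a0) _.
by rewrite lte_mul_pinfty// ?lnorm_ge0.
Qed.

HB.instance Definition _ :=
  GRing.isSubmodClosed.Build K (nat -> X) (ell_pred p1) ell_submod_closed.

Record ell := Ell { ell_seq :> nat -> X ; _ : ell_seq \in ell_pred p1 }.

HB.instance Definition _ := [isSub for ell_seq].
HB.instance Definition _ := [Choice of ell by <:].
HB.instance Definition _ := [SubChoice_isSubLmodule of ell by <:].

Definition ell_norm (x : ell) : K :=
  of_real s (fine (lnorm p (fun k => rnorm (x k)))).

Lemma ell_fin_num (x : ell) : (lnorm p (fun k => rnorm (x k)) \is a fin_num)%E.
Proof. by rewrite ge0_fin_numE ?lnorm_ge0//; case: x => x /=; rewrite inE. Qed.

Lemma ell_normD (x y : ell) : ell_norm (x + y) <= ell_norm x + ell_norm y.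
Proof.
rewrite -of_realD ler_of_real -fineD ?ell_fin_num// fine_le//.
- exact: ell_fin_num.
- by rewrite fin_numD !ell_fin_num.
apply: le_trans (lnormD p1 _ _); apply: le_lnorm => // k.
by rewrite !ger0_norm ?addr_ge0 ?rnorm_ge0// ler_rnormD.
Qed.

Lemma ell_normZ_le (a : K) (x : ell) : ell_norm (a *: x) <= `|a| * ell_norm x.
Proof.
have a0 : 0 <= to_real `|a| by rewrite -(@ler_of_real R s) of_real0 to_realK.
rewrite -[X in _ <= X * _]to_realK// -of_realM ler_of_real.
rewrite -[to_real `|a|]/(fine (to_real `|a|)%:E) -fineM ?ell_fin_num//.
rewrite fine_le ?ell_fin_num ?fin_numM ?ell_fin_num//.
apply: le_trans (lnormZ_le p1 _ a0); apply: le_lnorm => // k.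
by rewrite /= rnormZ.
Qed.

Lemma ell_normZ (a : K) (x : ell) : ell_norm (a *: x) = `|a| * ell_norm x.
Proof.
apply/eqP; rewrite eq_le ell_normZ_le/=.
have [->|a0] := eqVneq a 0.
  rewrite normr0 mul0r -(@of_real0 R s) ler_of_real fine_ge0//.
  exact: lnorm_ge0.
rewrite mulrC -ler_pdivlMr ?normr_gt0//.
rewrite -{1}[x](scalerK a0) mulrC -normfV; exact: ell_normZ_le.
Qed.

Lemma ell_norm_coord (x : ell) k : `|x k| <= ell_norm x.
Proof.
rewrite -rnormE ler_of_real -lee_fin fineK ?ell_fin_num//.
rewrite -[rnorm _]ger0_norm ?rnorm_ge0//.
exact: (lnorm_coord p1 (fun k => rnorm (x k))).
Qed.

Lemma ell_norm0_eq0 (x : ell) : ell_norm x = 0 -> x = 0.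
Proof.
move=> x0; apply/val_inj/funext => k /=; apply/normr0_eq0/eqP.
by rewrite eq_le normr_ge0 andbT -x0 ell_norm_coord.
Qed.

HB.instance Definition _ :=
  @Lmodule_isNormed.Build K ell ell_norm ell_normD ell_normZ ell_norm0_eq0.

End ell.

Lemma cauchy_small (K : numFieldType) (V : normedModType K) (F : set_system V) :
  ProperFilter F -> cauchy F -> forall e : K, 0 < e ->
  exists2 A, F A & forall x y, A x -> A y -> `|x - y| < e.
Proof.
move=> FF /cauchy_ballP Fc e e0.
have [[P Q]/= [FP FQ] PQ] := Fc e e0.
exists (P `&` Q); first exact: filterI.
move=> x y [Px _] [_ Qy]; have := PQ (x, y) (conj Px Qy).
by rewrite -ball_normE.
Qed.

Lemma small_cauchy (K : numFieldType) (V : normedModType K) (F : set_system V) :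
  ProperFilter F -> (forall e : K, 0 < e ->
  exists2 A, F A & forall x y, A x -> A y -> `|x - y| < e) -> cauchy F.
Proof.
move=> FF Fs; apply/cauchy_ballP => e e0.
have [A FA Ae] := Fs e e0; exists (A, A) => //= -[x y] /= [Ax Ay].
by rewrite -ball_normE; exact: Ae.
Qed.

Section ell_complete.
Context {R : realType} {s : scalars} (p : \bar R) (p1 : (1 <= p)%E).
Local Notation K := (scalar_field R s).
Variable X : completeNormedModType K.
Local Notation E := (ell p1 X).

Let normE (x : E) : `|x| = of_real s (fine (lnorm p (fun k => rnorm (x k)))).
Proof. by []. Qed.

Lemma ell_complete (F : set_system E) : ProperFilter F -> cauchy F -> cvg F.
Proof.
move=> FF Fc.
have coord k : cvg ((fun x : E => x k) @ F).
  apply: cauchy_cvg; apply: small_cauchy => e e0.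
  have [A FA Ae] := cauchy_small FF Fc e0.
  exists ((fun x : E => x k) @` A) => [|_ _ [x Ax <-] [y Ay <-]].
    by apply: (@filterS _ F _ A) => // x Ax; exists x.
  by apply: le_lt_trans (Ae _ _ Ax Ay); exact: (ell_norm_coord (x - y) k).
pose y k : X := lim ((fun x : E => x k) @ F).
have key (e : R) : 0 < e -> exists2 A, F A & forall x : E, A x ->
    (lnorm p (fun k => rnorm (x k - y k)%R) <= e%:E)%E.
  move=> e0; have e0' : 0 < of_real s e by rewrite -(@of_real0 R s) ltr_of_real.
  have [A FA Ae] := cauchy_small FF Fc e0'.
  exists A => // x Ax; apply: lnorm_trunc => // m.
  apply/lee_addgt0Pr => d d0.
  set L := lnorm p (trunc m (fun=> 1)).
  have Loo : (L < +oo)%E by exact: lnorm_trunc_lty.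
  have L0 : (0 <= L)%E by exact: lnorm_ge0.
  pose c := d / (fine L + 1).
  have c0 : 0 < c by rewrite divr_gt0// ltr_wpDl// fine_ge0.
  have nearF n : F [set x' : E | forall k, (k < n)%N -> rnorm (x' k - y k) <= c].
    elim: n => [|n IHn]; first by apply: filterE.
    have c0' : 0 < of_real s c by rewrite -(@of_real0 R s) ltr_of_real.
    have /cvgrPdist_le /(_ _ c0') := coord n.
    apply: filterS2 IHn => x' IHn x'n k; rewrite ltnS leq_eqVlt => /predU1P[->|].
      by rewrite -(@ler_of_real R s) rnormE distrC.
    exact: IHn.
  have [x' [Ax' x'y]] := filter_ex (filterI FA (nearF m)).
  have xx' : (lnorm p (fun k => rnorm ((x - x')%R k)) <= e%:E)%E.
    rewrite -(fineK (ell_fin_num (x - x'))) lee_fin -(@ler_of_real R s) -normE.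
    exact/ltW/Ae.
  have x'y' : (lnorm p (trunc m (fun k => rnorm (x' k - y k)%R)) <= d%:E)%E.
    apply: (@le_trans _ _ (c%:E * L)%E).
      apply: le_trans (lnormZ_le p1 _ (ltW c0)); apply: le_lnorm => // k.
      rewrite /trunc; case: ifPn => [km|_]; last by rewrite mulr0.
      by rewrite mulr1 !ger0_norm ?rnorm_ge0 ?(ltW c0)// x'y.
    rewrite -(@fineK _ L) ?ge0_fin_numE// -EFinM lee_fin /c.
    rewrite mulrAC ler_pdivrMr ?ltr_wpDl ?fine_ge0//.
    by rewrite ler_pM2l// lerDl.
  apply: le_trans (leeD xx' x'y'); apply: le_trans (lnormD p1 _ _).
  apply: le_lnorm => // k; rewrite /trunc; case: ifPn => [km|_].
    rewrite !ger0_norm ?addr_ge0 ?rnorm_ge0//.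
    apply: le_trans (ler_rnormD _ _).
    by rewrite /= -[x k - x' k + _]/(x k - x' k + _) addrA subrK.
  by rewrite normr0.
have [A FA Ay] := key 1 ltr01.
have [x0 Ax0] := filter_ex FA.
pose z k := x0 k - y k.
have zE : z \in ell_pred p1.
  by rewrite inE/=; apply: le_lt_trans (Ay _ Ax0) _; rewrite ltry.
pose y' : E := x0 - Ell zE.
have y'E k : y' k = y k by rewrite /= /z opprB addrC subrK.
apply/cvg_ex; exists y'; apply/cvgrPdist_le => e e0.
have e0' : 0 < to_real e by rewrite -(@ltr_of_real R s) of_real0 to_realK// ltW.
have [B FB By] := key _ e0'.
apply: filterS FB => x /By xy.
rewrite distrC normE -[leRHS]to_realK ?(ltW e0)// ler_of_real -lee_fin fineK ?ell_fin_num//.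
by under eq_fun do rewrite -[X in rnorm X]/(x _ - y' _) y'E.
Qed.

HB.instance Definition _ := Uniform_isComplete.Build E ell_complete.

End ell_complete.

Section subspace.
Context {K : numFieldType} {V : normedModType K} (S : {pred V}).
Hypothesis hS : submod_closed S.

(* Likewise, [h] only serves to key the instance. *)
Definition submod_pred (h : submod_closed S) : {pred V} := S.

HB.instance Definition _ :=
  GRing.isSubmodClosed.Build K V (submod_pred hS) hS.

Record submod := Submod { submod_val :> V ; _ : submod_val \in submod_pred hS }.

HB.instance Definition _ := [isSub for submod_val].
HB.instance Definition _ := [Choice of submod by <:].
HB.instance Definition _ := [SubChoice_isSubLmodule of submod by <:].

Definition submod_norm (x : submod) : K := `|submod_val x|.

Lemma submod_normD x y : submod_norm (x + y) <= submod_norm x + submod_norm y.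
Proof. exact: ler_normD. Qed.

Lemma submod_normZ (a : K) x : submod_norm (a *: x) = `|a| * submod_norm x.
Proof. exact: normrZ. Qed.

Lemma submod_norm0_eq0 x : submod_norm x = 0 -> x = 0.
Proof. by move=> /normr0_eq0 x0; apply/val_inj. Qed.

HB.instance Definition _ := @Lmodule_isNormed.Build K submod
  submod_norm submod_normD submod_normZ submod_norm0_eq0.

End subspace.

Lemma submod_complete (K : numFieldType) (V : completeNormedModType K)
    (S : {pred V}) (hS : submod_closed S) : closed [set x | x \in S] ->
  forall F : set_system (submod hS), ProperFilter F -> cauchy F -> cvg F.
Proof.
move=> cS F FF Fc.
have : cvg ((@submod_val _ _ _ hS) @ F).
  apply: cauchy_cvg; apply: small_cauchy => e e0.
  have [A FA Ae] := cauchy_small FF Fc e0.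
  exists ((@submod_val _ _ _ hS) @` A) => [|_ _ [x Ax <-] [y Ay <-]].
    by apply: (@filterS _ F _ A) => // x Ax; exists x.
  exact: Ae.
move=> /cvg_ex[/= l Fl].
have lS : l \in submod_pred hS.
  apply: (@closed_cvg _ _ _ FF (@submod_val _ _ _ hS) (fun v : V => v \in S) cS _ l Fl).
  by apply: filterE => -[].
apply/cvg_ex; exists (Submod lS); apply/cvgrPdist_le => e e0.
by have /cvgrPdist_le := Fl; exact.
Qed.

Section c0.
Context {R : realType} {s : scalars}.
Local Notation K := (scalar_field R s).

Definition ell_infty (X : normedModType K) := ell (leey 1) X.

HB.instance Definition _ (X : normedModType K) :=
  NormedModule.on (ell_infty X).
HB.instance Definition _ (X : completeNormedModType K) :=
  CompleteNormedModule.on (ell_infty X).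

Definition c0_pred (X : normedModType K) : {pred ell_infty X} :=
  mem [set x : ell_infty X | (fun k => rnorm (x k)) @ \oo --> (0 : R)].

Lemma c0_submod_closed (X : normedModType K) : submod_closed (@c0_pred X).
Proof.
split=> [|a x y]; rewrite !inE/=.
  rewrite (_ : (fun k => _) = fun=> 0); first exact: cvg_cst.
  by apply/funext => k; exact: rnorm0.
move=> x0 y0.
have xy0 : to_real `|a| * rnorm (x k) + rnorm (y k) @[k --> \oo] --> (0 : R).
  rewrite -[X in _ --> X]addr0 -[X in _ --> X + _](mulr0 (to_real `|a|)).
  by apply: cvgD => //; exact: cvgMr.
apply: (squeeze_cvgr _ (@cvg_cst _ (0 : R) _ \oo _) xy0).
apply: nearW => k; rewrite rnorm_ge0/=.
by apply: le_trans (ler_rnormD _ _) _; rewrite rnormZ.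
Qed.

(* Null sequences are bounded, so c_0(X) is the subspace of null sequences of
   l_oo(X), from which it inherits the supremum norm. *)
Definition c0 (X : normedModType K) := submod (c0_submod_closed X).

HB.instance Definition _ (X : normedModType K) := NormedModule.on (c0 X).

Lemma closed_c0 (X : normedModType K) : closed [set x | x \in @c0_pred X].
Proof.
move=> x clx; rewrite /= inE/=; apply/cvgrPdist_lt => e e0.
have e20 : 0 < of_real s (e / 2).
  by rewrite -(@of_real0 R s) ltr_of_real divr_gt0.
have [y [y0 xy]] := clx _ (nbhsx_ballx x _ e20).
have /cvgrPdist_lt /(_ (e / 2)) : (fun k => rnorm (y k)) @ \oo --> (0 : R).
  by move: y0; rewrite /= inE.
move=> /(_ (divr_gt0 e0 (ltr0Sn _ _))); apply: filterS => k.
rewrite !sub0r !normrN !ger0_norm ?rnorm_ge0// => yk.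
rewrite [e]splitr -(subrK (y k) (x k)).
apply: le_lt_trans (ler_rnormD _ _) _; apply: ltrD => //.
rewrite -(@ltr_of_real R s) rnormE.
move: xy; rewrite -ball_normE/=; apply: le_lt_trans.
exact: (ell_norm_coord (x - y) k).
Qed.

HB.instance Definition _ (X : completeNormedModType K) :=
  Uniform_isComplete.Build (c0 X)
    (@submod_complete _ (ell_infty X) _ (c0_submod_closed X) (@closed_c0 X)).

End c0.

Section operators.
Context {R : realType} {s : scalars}.
Local Notation K := (scalar_field R s).
Implicit Types X Y Z W : normedModType K.

Definition bounded_op X Y (T : X -> Y) : Prop :=
  exists M : R, forall x, rnorm (T x) <= M * rnorm x.

Definition opnorm X Y (T : X -> Y) : R :=
  sup [set rnorm (T x) | x in [set x | rnorm x <= 1]].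

Definition factors_through (C : R) Z W X Y
    (S : {linear Z -> W}) (T : {linear X -> Y}) : Prop :=
  exists (V : {linear Z -> X}) (U : {linear Y -> W}),
    [/\ bounded_op V, bounded_op U,
        forall z, U (T (V z)) = S z & opnorm U * opnorm V <= C].

Definition PFP (C : R) X : Prop :=
  forall T : {linear X -> X}, bounded_op T ->
    factors_through C (idfun : {linear X -> X}) T \/
    factors_through C (idfun : {linear X -> X}) (idfun \- T : {linear X -> X}).

Definition UPFP X : Prop := exists2 C : R, 1 <= C & PFP C X.

Definition isomorphic X Y : Prop :=
  exists (f : {linear X -> Y}) (g : {linear Y -> X}),
    [/\ continuous f, continuous g, cancel f g & cancel g f].

Definition range_pred X Y (T : {linear X -> Y}) : {pred Y} := mem (range T).

Lemma range_submod_closed X Y (T : {linear X -> Y}) :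
  submod_closed (range_pred T).
Proof.
split=> [|a _ _ /set_mem[x _ <-] /set_mem[y _ <-]]; apply/mem_set.
  by exists 0 => //; rewrite linear0.
by exists (a *: x + y) => //; rewrite linearP.
Qed.

Definition range_space X Y (T : {linear X -> Y}) : normedModType K :=
  submod (range_submod_closed T).

Definition primary X : Prop :=
  forall P : {linear X -> X}, bounded_op P -> (forall x, P (P x) = P x) ->
    isomorphic (range_space P) X \/
    isomorphic (range_space (idfun \- P : {linear X -> X})) X.

(* The Rademacher average is taken in L_2; by the Kahane-Khintchine
   inequality another exponent would only change C. *)
Definition has_cotype (q : R) X : Prop :=
  exists C : R, forall (n : nat) (x : 'I_n -> X),
    (\sum_(i < n) rnorm (x i) `^ q) `^ q^-1 <=
    C * Num.sqrt ((2 ^+ n)^-1 * \sum_(e : {ffun 'I_n -> bool})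
                    rnorm (\sum_(i < n) (-1) ^+ e i *: x i) ^+ 2).

Definition finite_cotype X : Prop := exists2 q : R, 2 <= q & has_cotype q X.

End operators.

(* Main.v *)
From HB Require Import structures.
Require Import Defs.
From mathcomp Require Import all_boot all_order all_algebra.
From mathcomp Require Import all_classical all_reals all_analysis.
From mathcomp Require Import lra.

(** Let [Y] be c_0(X) or l_oo(X) and [T] a bounded operator on [Y], seen as a
    matrix of operators on [X].  The idea is to find infinitely many indices
    along which the matrix is almost diagonal.  The diagonal entries are then
    handled one at a time by the uniform factorisation property of [X], and a
    Neumann series absorbs the rest.

    Both hypotheses on [X] are used through one consequence,
    [has_sign_small_copies]: [X] has uniformly complemented copies of itself,
    with embeddings [J m] and projections [Q m], such that if all the signed sums
    of z_1, ..., z_N are bounded by a given constant and [N] is large, then some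
    [Q r (z r)] is small.  If [X] has finite cotype, take [J m] and [Q m] to be
    the identity.  If [X] is isomorphic to l_p(X), take the coordinate embeddings
    and projections: averaging the p-th powers of the norms over all signs,
    disjoint coordinates add up, so the number of [r] with [Q r (z r)] large is
    bounded.

    Say that a set [A] of columns is big for the row [i] if, for every [m], the
    restriction of that row to [A], followed by [Q m], has norm above a threshold
    e.  Vectors with disjoint supports have bounded signed sums in [Y], so a row
    cannot have too many disjoint big sets, and the bound is the same for all
    rows.  This suffices for Rosenthal's disjointness lemma
    ([rosenthal_disjointness]), whose classical form concerns measures: there are
    infinitely many indices mu_k, and a choice of m_k, such that the row mu_k
    followed by [Q m_k] has norm at most e on all the other selected columns.
    Put D_k = Q_{m_k} T_{mu_k, mu_k} J_{m_k}.  The identity of [X] factors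
    with one constant through D_k for infinitely many [k], or through I - D_k for
    infinitely many [k]; since the compression of I - T has diagonal I - D_k and,
    up to sign, the same off-diagonal entries as that of [T], the identity of [Y]
    factors through [T] or through I - T ([almost_diagonal_factors]).

    Primarity follows from the factorisation property by Pelczynski's
    decomposition method ([pelczynski_decomposition]), since [Y] is isomorphic to
    the corresponding sum of infinitely many copies of itself. *)

Set Implicit Arguments.
Unset Strict Implicit.
Unset Printing Implicit Defensive.

Import Order.TTheory GRing.Theory Num.Theory.
Import numFieldNormedType.Exports.

Local Open Scope classical_set_scope.
Local Open Scope ring_scope.

(** * Bounded operators and the Neumann series *)

Section operator_basics.
Context {R : realType} {s : scalars}.
Local Notation K := (scalar_field R s).
Implicit Types X Y Z W : normedModType K.

Lemma rnorm_scale X (a : R) (x : X) : 0 <= a ->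
  rnorm (of_real s a *: x) = a * rnorm x.
Proof.
move=> a0; rewrite rnormZ ger0_norm ?of_realK//.
by rewrite -(@of_real0 R s) ler_of_real.
Qed.

Lemma rnormBC X (x y : X) : rnorm (x - y) = rnorm (y - x).
Proof. by rewrite -opprB rnormN. Qed.

Lemma rnorm_signZ X (b : bool) (x : X) : rnorm ((-1) ^+ b *: x) = rnorm x.
Proof. by case: b; rewrite ?expr1 ?expr0 ?scaleN1r ?rnormN ?scale1r. Qed.

Lemma exists_linear X Y (f : X -> Y) : linear f ->
  exists F : {linear X -> Y}, forall x, F x = f x.
Proof.
move=> lf; pose fl := GRing.isLinear.Build K X Y *:%R f lf.
by exists (HB.pack_for {linear X -> Y} f fl).
Qed.

Lemma bounded_op_gt0 X Y (T : X -> Y) : bounded_op T ->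
  exists2 M, 0 < M & forall x, rnorm (T x) <= M * rnorm x.
Proof.
move=> [M TM]; exists (`|M| + 1) => [|x]; first exact: ltr_wpDl.
apply: le_trans (TM x) _; rewrite ler_wpM2r ?rnorm_ge0//.
by rewrite (le_trans (ler_norm M)) ?lerDl.
Qed.

Lemma bounded_op_comp X Y Z (S : Y -> Z) (T : X -> Y) :
  bounded_op S -> bounded_op T -> bounded_op (S \o T).
Proof.
move=> /bounded_op_gt0[M M0 SM] [N TN]; exists (M * N) => x /=.
by rewrite (le_trans (SM _))// -mulrA ler_pM2l.
Qed.

Lemma bounded_opD X Y (S T : X -> Y) :
  bounded_op S -> bounded_op T -> bounded_op (S \+ T).
Proof.
move=> [M SM] [N TN]; exists (M + N) => x /=.
by rewrite (le_trans (ler_rnormD _ _))// mulrDl lerD.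
Qed.

Lemma bounded_opN X Y (T : X -> Y) : bounded_op T -> bounded_op (\- T).
Proof. by move=> [M TM]; exists M => x /=; rewrite rnormN. Qed.

Lemma bounded_op_id X : bounded_op (@idfun X).
Proof. by exists 1 => x; rewrite mul1r. Qed.

Lemma bounded_op_continuous X Y (T : {linear X -> Y}) :
  bounded_op T -> continuous T.
Proof.
move=> /bounded_op_gt0[M M0 TM]; apply: bounded_linear_continuous.
apply/bounded_funP => r; exists (of_real s M * r) => x xr.
apply: (@le_trans _ _ (of_real s M * `|x|)); last first.
  by rewrite ler_wpM2l// -(@of_real0 R s) ler_of_real ltW.
by rewrite -!rnormE -of_realM ler_of_real.
Qed.

Lemma continuous_bounded_op X Y (T : {linear X -> Y}) :
  continuous T -> bounded_op T.
Proof.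
move=> /linear_bounded_continuous/linear_boundedP/pinfty_ex_gt0[r r0 Tr].
exists (to_real r) => x; rewrite -(@ler_of_real R s) of_realM !rnormE.
by rewrite to_realK ?(ltW r0).
Qed.

Lemma opnorm_le X Y (T : {linear X -> Y}) (M : R) : 0 <= M ->
  (forall x, rnorm (T x) <= M * rnorm x) -> opnorm T <= M.
Proof.
move=> M0 TM; apply: ge_sup.
  by exists (rnorm (T 0)), 0 => //=; rewrite rnorm0.
move=> _ [x /= x1 <-]; apply: le_trans (TM x) _.
by rewrite -[leRHS]mulr1 ler_wpM2l.
Qed.

Lemma le_opnorm X Y (T : {linear X -> Y}) : bounded_op T ->
  forall x, rnorm (T x) <= opnorm T * rnorm x.
Proof.
move=> /bounded_op_gt0[M M0 TM] x.
have [x0|x0] := eqVneq (rnorm x) 0.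
  by rewrite (rnorm0_eq0 x0) linear0 !rnorm0 mulr0.
have xgt0 : 0 < rnorm x by rewrite lt_def x0 rnorm_ge0.
rewrite -ler_pdivrMr// mulrC -rnorm_scale ?invr_ge0 ?rnorm_ge0//.
rewrite -linearZ/=; apply: sup_upper_bound.
  split; first by exists (rnorm (T 0)), 0 => //=; rewrite rnorm0.
  exists M => _ [y /= y1 <-]; apply: le_trans (TM y) _.
  by rewrite -[leRHS]mulr1 ler_pM2l.
exists (of_real s (rnorm x)^-1 *: x) => //=.
by rewrite rnorm_scale ?invr_ge0 ?rnorm_ge0// mulVf.
Qed.

Lemma opnorm_ge0 X Y (T : {linear X -> Y}) : bounded_op T -> 0 <= opnorm T.
Proof.
move=> /bounded_op_gt0[M M0 TM]; apply: sup_upper_bound; last first.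
  by exists 0 => /=; rewrite ?linear0 ?rnorm0.
split; first by exists (rnorm (T 0)), 0 => //=; rewrite rnorm0.
exists M => _ [y /= y1 <-]; apply: le_trans (TM y) _.
by rewrite -[leRHS]mulr1 ler_pM2l.
Qed.

(** A factorisation can be rescaled so that its first factor has norm at most 1.
    Infinitely many such factorisations can then be assembled coordinatewise. *)
Lemma factors_through_id_contraction (C : R) X (T : {linear X -> X}) :
    0 <= C -> factors_through C (idfun : {linear X -> X}) T ->
  exists (V U : {linear X -> X}),
    [/\ forall x, rnorm (V x) <= rnorm x,
        forall x, rnorm (U x) <= C * rnorm x & forall x, U (T (V x)) = x].
Proof.
move=> C0 [V [U [bV bU UTV UVC]]].
have V0 := opnorm_ge0 bV; have leV := le_opnorm bV.
have [V00|Vn0] := eqVneq (opnorm V) 0.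
  (* If [V] vanishes then so does [X]. *)
  have X0 (x : X) : rnorm x = 0.
    have /eqP : rnorm (V x) == 0.
      by rewrite eq_le rnorm_ge0 andbT (le_trans (leV x))// V00 mul0r.
    by move=> /rnorm0_eq0 Vx; rewrite -[x]/(idfun x) -UTV Vx !linear0 rnorm0.
  by exists V, U; split=> x; rewrite ?X0 ?mulr0//; exact: UTV.
have Vgt0 : 0 < opnorm V by rewrite lt_def Vn0.
have [V' V'E] : exists V' : {linear X -> X}, forall x,
    V' x = of_real s (opnorm V)^-1 *: V x.
  apply: exists_linear => a x y; rewrite linearP scalerDr !scalerA.
  by rewrite (mulrC a).
have [U' U'E] : exists U' : {linear X -> X}, forall x,
    U' x = of_real s (opnorm V) *: U x.
  apply: exists_linear => a x y; rewrite linearP scalerDr !scalerA.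
  by rewrite (mulrC a).
exists V', U'; split=> x.
- by rewrite V'E rnorm_scale ?invr_ge0// ler_pdivrMl.
- rewrite U'E rnorm_scale//; apply: le_trans (ler_wpM2l V0 (le_opnorm bU x)) _.
  by rewrite mulrA ler_wpM2r ?rnorm_ge0// mulrC.
- rewrite U'E V'E !linearZ/= UTV scalerA -of_realM mulVf//.
  by rewrite of_real1 scale1r.
Qed.

Lemma factors_through_bounds (v u : R) X (T : {linear X -> X})
    (V U : {linear X -> X}) : 0 <= v -> 0 <= u ->
    (forall x, rnorm (V x) <= v * rnorm x) ->
    (forall x, rnorm (U x) <= u * rnorm x) ->
    (forall x, U (T (V x)) = x) ->
  factors_through (u * v) (idfun : {linear X -> X}) T.
Proof.
move=> v0 u0 Vv Uu UTV; exists V, U; split=> //; [by exists v|by exists u|].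
by rewrite ler_pM ?opnorm_le//; apply: opnorm_ge0; [exists u|exists v].
Qed.

End operator_basics.

Section neumann.
Context {R : realType} {s : scalars}.
Local Notation K := (scalar_field R s).
Variable Y : completeNormedModType K.

Lemma cvg_rnorm_cauchy (x : nat -> Y) :
    (forall e : R, 0 < e -> exists N, forall m n, (N <= m)%N -> (N <= n)%N ->
      rnorm (x m - x n) < e) ->
  exists l : Y, forall e : R, 0 < e -> exists N, forall n, (N <= n)%N ->
    rnorm (l - x n) < e.
Proof.
move=> xc; have : cvg (x @ \oo).
  apply: cauchy_cvg; apply: small_cauchy => e e0.
  have e0' : 0 < to_real e by rewrite -(@ltr_of_real R s) of_real0 to_realK// ltW.
  have [N xN] := xc _ e0'.
  exists [set x n | n in [set n | (N <= n)%N]].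
    by exists N => // n /= Nn; exists n.
  move=> _ _ [m /= Nm <-] [n /= Nn <-].
  by rewrite -rnormE -[ltRHS]to_realK ?ltr_of_real ?xN// ltW.
move=> /cvg_ex[l xl]; exists l => e e0.
have e0' : 0 < of_real s e by rewrite -(@of_real0 R s) ltr_of_real.
have /cvgrPdist_lt /(_ _ e0') [N _ xN] := xl.
by exists N => n Nn; rewrite -(@ltr_of_real R s) rnormE; exact: xN.
Qed.

(** Neumann series: an operator within 1/2 of the identity is invertible, with
    an inverse of norm at most 2.  Only the left inverse is recorded. *)
Lemma neumann_left_inverse (G : {linear Y -> Y}) :
    (forall x, rnorm (G x - x) <= 2^-1 * rnorm x) ->
  exists W : {linear Y -> Y}, (forall x, W (G x) = x) /\
    (forall y, rnorm (W y) <= 2 * rnorm y).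
Proof.
move=> GE.
have Glb x : rnorm x <= 2 * rnorm (G x).
  have := ler_rnormD (G x) (x - G x); rewrite subrKC => /= h.
  have := GE x; rewrite rnormBC; lra.
have Ginj x x' : G x = G x' -> x = x'.
  move=> xx'; apply/subr0_eq/rnorm0_eq0.
  by have := Glb (x - x'); rewrite linearB xx' subrr rnorm0 => h;
    apply/eqP; rewrite eq_le rnorm_ge0 andbT; lra.
have Gsurj y : exists x, G x = y.
  (* The solution is the limit of the iterates of the contraction [f]. *)
  pose f x := y - (G x - x); pose u n := iter n f 0.
  have fB x x' : f x - f x' = - (G (x - x') - (x - x')).
    rewrite /f (linearB G) !opprB addrC subrKA addrC addrACA [RHS]addrACA.
    by congr (_ + _); exact: addrC.
  have fBn x x' : rnorm (f x - f x') <= 2^-1 * rnorm (x - x').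
    by rewrite fB rnormN.
  have ubd n : rnorm (u n) <= 2 * rnorm y.
    elim: n => [|n IH]; first by rewrite rnorm0 mulr_ge0 ?rnorm_ge0.
    rewrite /u iterS -/(u n) {1}/f; apply: le_trans (ler_rnormD _ _) _.
    by rewrite rnormN; have := GE (u n); lra.
  have udist n m : rnorm (u (n + m)%N - u n) <= 2^-1 ^+ n * (2 * rnorm y).
    elim: n => [|n IH]; first by rewrite expr0 mul1r subr0.
    rewrite addSn /u !iterS -!/(u _); apply: le_trans (fBn _ _) _.
    by rewrite exprS -mulrA ler_wpM2l.
  have small e : 0 < e -> exists N, 2^-1 ^+ N * (2 * rnorm y) < e.
    move=> e0; have c0 : 0 <= 2 * rnorm y by rewrite mulr_ge0 ?rnorm_ge0.
    have e0' : 0 < e / (2 * rnorm y + 1) by rewrite divr_gt0// ltr_wpDl.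
    have h1 : `|2^-1 : R| < 1 by rewrite ger0_norm ?invr_ge0// invf_lt1 ?ltr1n.
    have /cvgrPdist_lt /(_ _ e0')[N _ /(_ N (leqnn N))] := @cvg_geometric R 1 _ h1.
    rewrite /= mul1r sub0r normrN ger0_norm ?exprn_ge0 ?invr_ge0// => hN.
    exists N; apply: (@le_lt_trans _ _ (2^-1 ^+ N * (2 * rnorm y + 1))).
      by rewrite ler_wpM2l ?exprn_ge0 ?invr_ge0// lerDl.
    by rewrite -ltr_pdivlMr// ltr_wpDl.
  have [l ul] : exists l : Y, forall e : R, 0 < e -> exists N, forall n,
      (N <= n)%N -> rnorm (l - u n) < e.
    apply: cvg_rnorm_cauchy => e e0.
    have [N hN] := small (e / 2) (divr_gt0 e0 (ltr0Sn _ 1)).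
    exists N => m n Nm Nn.
    rewrite -(subrKA (u N)); apply: le_lt_trans (ler_rnormD _ _) _.
    have := udist N (m - N)%N; have := udist N (n - N)%N.
    rewrite !subnKC// (rnormBC (u N)); lra.
  exists l; apply/subr0_eq/rnorm0_eq0/eqP.
  rewrite eq_le rnorm_ge0 andbT; apply/ler_addgt0Pr => e e0; rewrite add0r.
  have [N hN] := ul (e / 2) (divr_gt0 e0 (ltr0Sn _ 1)).
  have -> : G l - y = (l - u N.+1) - (f l - f (u N)).
    by rewrite (_ : u N.+1 = f (u N))// (opprB (f l)) subrKA /f opprB addrA subrKC.
  apply: le_trans (ler_rnormD _ _) _; rewrite rnormN.
  have := fBn l (u N); have := hN N (leqnn N); have := hN N.+1 (leqnSn N).
  have := rnorm_ge0 (l - u N); lra.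
pose w y := projT1 (cid (Gsurj y)).
have Gw y : G (w y) = y by rewrite /w; case: cid.
have [W WE] : exists W : {linear Y -> Y}, forall y, W y = w y.
  by apply: exists_linear => a x y; apply: Ginj; rewrite linearP !Gw.
exists W; split=> [x|y]; first by apply: Ginj; rewrite WE Gw.
by rewrite WE; apply: le_trans (Glb _) _; rewrite Gw.
Qed.

End neumann.

(** * Spaces of sequences under the supremum norm *)

(** The index of the [b]-th entry of the [a]-th block in the partition of the
    natural numbers into infinitely many infinite blocks: block 0 consists of
    the even numbers, and [n |-> 2n + 1] maps block [a] onto block [a + 1]. *)
Fixpoint blk (a b : nat) : nat :=
  if a is a'.+1 then (blk a' b).*2.+1 else b.*2.

Lemma blk_inj a b a' b' : blk a b = blk a' b' -> a = a' /\ b = b'.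
Proof.
elim: a a' => [|a IH] [|a'] //=.
- by move=> /(congr1 half); rewrite !doubleK.
- by move=> /(congr1 odd); rewrite /= !odd_double.
- by move=> /(congr1 odd); rewrite /= !odd_double.
- by move=> [/(congr1 half)]; rewrite !doubleK => /IH[-> ->].
Qed.

Lemma blk_surj n : exists a b, n = blk a b.
Proof.
elim/ltn_ind: n => n IH; rewrite -(odd_double_half n).
have [on|_] := boolP (odd n); last by exists 0%N, n./2.
have [|a [b ->]] := IH n./2; last by exists a.+1, b.
rewrite -[ltnRHS]odd_double_half on add1n ltnS -addnn; exact: leq_addr.
Qed.

Lemma leq_blkl a b : (a <= blk a b)%N.
Proof.
elim: a => //= a IH; rewrite ltnS (leq_trans IH)// -addnn; exact: leq_addr.
Qed.

Lemma leq_blkr a b : (b <= blk a b)%N.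
Proof.
elim: a => [|a IH] /=; first by rewrite -addnn leq_addr.
by rewrite (leq_trans IH)// -addnn leqW// leq_addr.
Qed.

Lemma leq_blk a b a' b' : (a <= a')%N -> (b <= b')%N -> (blk a b <= blk a' b')%N.
Proof.
elim: a a' => [|a IH] [|a'] //=; first by rewrite leq_double.
- move=> _ bb; rewrite leqW// leq_double (leq_trans bb)//; exact: leq_blkr.
- by rewrite !ltnS leq_double; exact: IH.
Qed.

(** [h] tends to infinity. *)
Definition tends_to_infinity (h : nat -> nat) : Prop :=
  forall k, exists N, forall n, (N <= n)%N -> (k <= h n)%N.

Lemma leq_tends_to_infinity (h : nat -> nat) (f : nat -> nat) :
  tends_to_infinity f -> (forall n, (f n <= h n)%N) -> tends_to_infinity h.
Proof.
move=> foo fh k; have [N Nf] := foo k.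
by exists N => n /Nf kn; exact: leq_trans (fh n).
Qed.

Lemma tends_to_infinity_id : tends_to_infinity id.
Proof. by move=> k; exists k. Qed.

Lemma tends_to_infinity_half : tends_to_infinity half.
Proof. by move=> k; exists k.*2 => n kn; rewrite -[k]doubleK half_leq. Qed.

Lemma injective_tends_to_infinity (h : nat -> nat) :
  injective h -> tends_to_infinity h.
Proof.
move=> hinj; elim=> [|k [N Nh]]; first by exists 0%N.
have [[n hn]|nh] := pselect (exists n, h n = k).
  exists (maxn N n.+1) => m; rewrite geq_max => /andP[Nm nm].
  rewrite ltn_neqAle Nh// andbT; apply: contraTneq nm => hm.
  by rewrite -leqNgt -(hinj m n) // hn.
exists N => m Nm; rewrite ltn_neqAle Nh// andbT; apply/eqP => hm.
by apply: nh; exists m.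
Qed.

Section sup_sequence_space.
Context {R : realType} {s : scalars}.
Local Notation K := (scalar_field R s).

(** [Y], with coordinates [co], is a space of sequences in [X] under the
    supremum norm which contains the finitely supported sequences and is closed
    under domination along a reindexing that tends to infinity, and under
    assembling, along the blocks [blk a], sequences controlled by the blocks of
    a member.  These are the features shared by c_0(X) and l_oo(X) on which the
    argument relies. *)
Record sup_sequence_space (X Y : normedModType K) (co : Y -> nat -> X) : Prop := {
  co_linear : forall (a : K) x y n, co (a *: x + y) n = a *: co x n + co y n;
  rnorm_co_le : forall y n, rnorm (co y n) <= rnorm y;
  rnorm_le_co : forall y (M : R), 0 <= M ->
    (forall n, rnorm (co y n) <= M) -> rnorm y <= M;
  co_single : forall n x, exists y, forall k, co y k = if k == n then x else 0;
  co_dominated : forall y (g : nat -> X) (h : nat -> nat) (c : R),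
    tends_to_infinity h ->
    (forall n, rnorm (g n) <= c * rnorm (co y (h n))) ->
    exists z, forall n, co z n = g n;
  co_blocks : forall y (z : nat -> Y) (c : R), 0 <= c ->
    (forall a (M : R), 0 <= M -> (forall b, rnorm (co y (blk a b)) <= M) ->
      rnorm (z a) <= c * M) ->
    exists w, forall a b, co w (blk a b) = co (z a) b }.

Lemma ell_infty_norm_le (X : normedModType K) (y : ell_infty X) (M : R) :
  (forall n, rnorm (y n) <= M) -> rnorm y <= M.
Proof.
move=> yM; rewrite -(@ler_of_real R s) rnormE ler_of_real -lee_fin fineK.
  by apply: ge_ereal_sup => _ [k _ <-]; rewrite lee_fin ger0_norm ?rnorm_ge0.
exact: (ell_fin_num y).
Qed.

Lemma ell_infty_coord_le (X : normedModType K) (y : ell_infty X) n :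
  rnorm (y n) <= rnorm y.
Proof. by rewrite -(@ler_of_real R s) !rnormE; exact: (ell_norm_coord y n). Qed.

Lemma bounded_ell_infty (X : normedModType K) (g : nat -> X) (M : R) :
  (forall n, rnorm (g n) <= M) -> exists z : ell_infty X, forall n, z n = g n.
Proof.
move=> gM; have gE : g \in ell_pred (X := X) (leey (1 : \bar R)).
  rewrite inE /=; apply: (@le_lt_trans _ _ M%:E); last by rewrite ltry.
  by apply: ge_ereal_sup => _ [k _ <-]; rewrite lee_fin ger0_norm ?rnorm_ge0.
by exists (Ell gE).
Qed.

Lemma ell_infty_sup_sequence_space (X : normedModType K) :
  sup_sequence_space (fun (y : ell_infty X) n => y n).
Proof.
split=> //.
- by move=> y n; exact: ell_infty_coord_le.
- by move=> y M _; exact: ell_infty_norm_le.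
- move=> n x; apply: (@bounded_ell_infty _ _ (rnorm x)) => k.
  by case: ifP; rewrite ?rnorm0 ?rnorm_ge0.
- move=> y g h c hoo gy.
  apply: (@bounded_ell_infty _ _ (`|c| * rnorm y)) => n.
  apply: le_trans (gy n) _; apply: le_trans (ler_wpM2r (rnorm_ge0 _) (ler_norm c)) _.
  by rewrite ler_wpM2l// ell_infty_coord_le.
- move=> y z c c0 yz.
  have /choice[u uE] : forall n, exists ab, n = blk ab.1 ab.2.
    by move=> n; have [a [b ->]] := blk_surj n; exists (a, b).
  have [n|w wE] := @bounded_ell_infty _ (fun n => z (u n).1 (u n).2) (c * rnorm y).
    apply: le_trans (ell_infty_coord_le _ _) _; apply: yz; first exact: rnorm_ge0.
    by move=> b; exact: ell_infty_coord_le.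
  exists w => a b; rewrite wE.
  by have /blk_inj[<- <-] := uE (blk a b).
Qed.

Lemma c0P (X : normedModType K) (y : ell_infty X) :
  y \in @c0_pred _ _ X <-> forall e : R, 0 < e -> exists N, forall n, (N <= n)%N ->
    rnorm (y n) <= e.
Proof.
rewrite inE /=; split=> [/cvgrPdist_le y0 e e0|y0].
  have [N _ yN] := y0 _ e0; exists N => n /yN /=.
  by rewrite sub0r normrN ger0_norm ?rnorm_ge0.
apply/cvgrPdist_le => e e0; have [N yN] := y0 e e0.
exists N => // n /yN /=.
by rewrite sub0r normrN ger0_norm ?rnorm_ge0.
Qed.

Lemma null_c0 (X : normedModType K) (g : nat -> X) (M : R) :
    (forall n, rnorm (g n) <= M) ->
    (forall e : R, 0 < e -> exists N, forall n, (N <= n)%N -> rnorm (g n) <= e) ->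
  exists z : c0 X, forall n, submod_val z n = g n.
Proof.
move=> gM g0; have [y yE] := bounded_ell_infty gM.
have yc : y \in submod_pred (@c0_submod_closed _ _ X).
  apply/c0P => e /g0[N gN].
  by exists N => n Nn; rewrite yE gN.
by exists (Submod yc) => n; exact: yE.
Qed.

Lemma c0_null (X : normedModType K) (z : c0 X) (e : R) : 0 < e ->
  exists N, forall n, (N <= n)%N -> rnorm (submod_val z n) <= e.
Proof. by case: z => z zc e0 /=; move/c0P : zc => /(_ e e0). Qed.

Lemma c0_sup_sequence_space (X : normedModType K) :
  sup_sequence_space (fun (y : c0 X) n => submod_val y n).
Proof.
have coord_le (y : c0 X) n : rnorm (submod_val y n) <= rnorm y.
  exact: (ell_infty_coord_le (submod_val y) n).
split=> //.
- by move=> y M _; exact: (@ell_infty_norm_le _ (submod_val y)).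
- move=> n x; apply: (@null_c0 _ _ (rnorm x)) => [k|e e0].
    by case: ifP; rewrite ?rnorm0 ?rnorm_ge0.
  exists n.+1 => k; case: eqP => [->|_]; first by rewrite ltnn.
  by rewrite rnorm0 ltW.
- move=> y g h c hoo gy.
  have {}gy n : rnorm (g n) <= (`|c| + 1) * rnorm (submod_val y (h n)).
    apply: le_trans (gy n) _; apply: ler_wpM2r; first exact: rnorm_ge0.
    by rewrite (le_trans (ler_norm c))// lerDl.
  have c0 : 0 < `|c| + 1 by rewrite ltr_wpDl.
  apply: (@null_c0 _ _ ((`|c| + 1) * rnorm y)) => [n|e e0].
    by apply: le_trans (gy n) _; rewrite ler_pM2l.
  have [N yN] := c0_null y (divr_gt0 e0 c0); have [N' hN'] := hoo N.
  exists N' => n /hN' /yN yn; apply: le_trans (gy n) _.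
  by rewrite mulrC -ler_pdivlMr.
- move=> y z c c0 yz.
  have /choice[u uE] : forall n, exists ab, n = blk ab.1 ab.2.
    by move=> n; have [a [b ->]] := blk_surj n; exists (a, b).
  have [n|e e0|w wE] := @null_c0 _ (fun n => submod_val (z (u n).1) (u n).2)
      (c * rnorm y).
  + apply: le_trans (coord_le _ _) _; apply: yz; first exact: rnorm_ge0.
    by move=> b; exact: coord_le.
  + (* Late blocks are small by hypothesis; each of the finitely many early
       ones is a null sequence. *)
    have c1 : 0 < c + 1 by rewrite ltr_wpDl.
    have [A yA] := c0_null y (divr_gt0 e0 c1).
    have /choice[B zB] : forall a, exists N, forall n, (N <= n)%N ->
        rnorm (submod_val (z a) n) <= e by move=> a; exact: c0_null.
    exists (blk A (\max_(a < A) B a)) => n; rewrite [n in (_ <= n)%N]uE => nAB.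
    have [aA|Aa] := ltnP (u n).1 A.
      apply: zB; apply: leq_trans (@leq_bigmax _ (fun a : 'I_A => B a) (Ordinal aA)) _.
      have [//|bB] := leqP (\max_(a < A) B a) (u n).2.
      have lt := leq_blk (ltnW aA) (ltnW bB).
      have /eqP/blk_inj[uA _] : blk (u n).1 (u n).2 == blk A (\max_(a < A) B a).
        by rewrite eqn_leq lt nAB.
      by rewrite uA ltnn in aA.
    apply: le_trans (coord_le _ _) _.
    apply: (@le_trans _ _ (c * (e / (c + 1)))).
      apply: yz => [|b]; first by rewrite divr_ge0 ?ltW.
      by apply: yA; apply: leq_trans Aa _; exact: leq_blkl.
    by rewrite mulrCA ler_piMr ?ltW// ltr_pdivrMr// mul1r ltrDl.
  + exists w => a b; rewrite wE.
    by have /blk_inj[<- <-] := uE (blk a b).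
Qed.

End sup_sequence_space.

(** * Operators given by coordinates and the decomposition method *)

Section coordinates.
Context {R : realType} {s : scalars}.
Local Notation K := (scalar_field R s).
Context {X Y : normedModType K} {co : Y -> nat -> X}.
Hypothesis Yco : sup_sequence_space co.

Lemma co_ext x y : (forall n, co x n = co y n) -> x = y.
Proof.
move=> xy; apply/subr0_eq/rnorm0_eq0/eqP; rewrite eq_le rnorm_ge0 andbT.
apply: (rnorm_le_co Yco) => // n.
have := co_linear Yco (-1) y x n.
by rewrite !scaleN1r addrC => ->; rewrite xy addNr rnorm0.
Qed.

Lemma coD x y n : co (x + y) n = co x n + co y n.
Proof. by rewrite -[x in LHS]scale1r (co_linear Yco) scale1r. Qed.

Lemma co0 n : co 0 n = 0.
Proof. by apply: (addrI (co 0 n)); rewrite -coD !addr0. Qed.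

Lemma coZ a x n : co (a *: x) n = a *: co x n.
Proof. by rewrite -[a *: x]addr0 (co_linear Yco) co0 addr0. Qed.

Lemma coB x y n : co (x - y) n = co x n - co y n.
Proof. by rewrite coD -scaleN1r coZ scaleN1r. Qed.

Lemma co_sum (I : Type) (r : seq I) (P : pred I) (F : I -> Y) n :
  co (\sum_(i <- r | P i) F i) n = \sum_(i <- r | P i) co (F i) n.
Proof. by apply: (big_morph (co^~ n)) => [x y|]; [exact: coD|exact: co0]. Qed.

(** Operators on [Y] are defined by prescribing the coordinates of the image. *)
Lemma exists_co_op (F : Y -> nat -> X) (c : R) :
    (forall a x y n, F (a *: x + y) n = a *: F x n + F y n) ->
    (forall y, exists z, forall n, co z n = F y n) ->
    0 <= c -> (forall y n, rnorm (F y n) <= c * rnorm y) ->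
  exists G : {linear Y -> Y}, (forall y n, co (G y) n = F y n) /\
    forall y, rnorm (G y) <= c * rnorm y.
Proof.
move=> Flin Fmem c0 Fc.
have /choice[g gE] := Fmem.
have [G GE] : exists G : {linear Y -> Y}, forall y, G y = g y.
  by apply: exists_linear => a x y; apply: co_ext => n;
    rewrite (co_linear Yco) !gE Flin.
exists G; split=> [y n|y]; first by rewrite GE gE.
apply: (rnorm_le_co Yco) => [|n]; first by rewrite mulr_ge0 ?rnorm_ge0.
by rewrite GE gE Fc.
Qed.

(** When the image is dominated along a reindexing [h] it belongs to [Y]. *)
Lemma exists_co_op_dominated (F : Y -> nat -> X) (h : nat -> nat) (c : R) :
    (forall a x y n, F (a *: x + y) n = a *: F x n + F y n) ->
    tends_to_infinity h -> 0 <= c ->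
    (forall y n, rnorm (F y n) <= c * rnorm (co y (h n))) ->
  exists G : {linear Y -> Y}, (forall y n, co (G y) n = F y n) /\
    forall y, rnorm (G y) <= c * rnorm y.
Proof.
move=> Flin hoo c0 Fh; apply: exists_co_op => // [y|y n].
  exact: (co_dominated Yco hoo (Fh y)).
by apply: le_trans (Fh y n) _; rewrite ler_wpM2l// (rnorm_co_le Yco).
Qed.

Lemma exists_reindex (h : nat -> nat) : tends_to_infinity h ->
  exists G : {linear Y -> Y}, (forall y n, co (G y) n = co y (h n)) /\
    bounded_op G.
Proof.
move=> hoo.
have [a x y n||y n|G [GE G1]] := @exists_co_op_dominated (fun y n => co y (h n)) h 1 _ hoo.
- by rewrite (co_linear Yco).
- by [].
- by rewrite mul1r.
- by exists G; split => //; exists 1.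
Qed.

(** Copying a sequence to the odd positions, for [b = true], or to the even ones,
    for [b = false]. *)
Lemma exists_spread (b : bool) :
  exists G : {linear Y -> Y},
    (forall y n, co (G y) n = if odd n == b then co y n./2 else 0) /\ bounded_op G.
Proof.
have [a x y n||y n|G [GE G1]] := @exists_co_op_dominated
  (fun y n => if odd n == b then co y n./2 else 0) half 1 _ tends_to_infinity_half.
- by case: ifP => _; rewrite ?(co_linear Yco)// scaler0 addr0.
- by [].
- by rewrite mul1r; case: ifP; rewrite ?rnorm0 ?rnorm_ge0.
- by exists G; split => //; exists 1.
Qed.

(** The amplification of [A]: the operator acting as [A] on each block. *)
Lemma exists_amplification (A : {linear Y -> Y}) : bounded_op A ->
  exists G : {linear Y -> Y}, [/\ bounded_op G &
    forall (a : nat) (r : {linear Y -> Y}),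
      (forall y b, co (r y) b = co y (blk a b)) -> forall y, r (G y) = A (r y)].
Proof.
move=> /bounded_op_gt0[M M0 AM].
have blkoo a : tends_to_infinity (blk a).
  exact: (leq_tends_to_infinity tends_to_infinity_id (leq_blkr a)).
have /choice[r rP] := fun a => exists_reindex (blkoo a).
have rE a y b : co (r a y) b = co y (blk a b) by case: (rP a).
have rA y a (N : R) : 0 <= N -> (forall b, rnorm (co y (blk a b)) <= N) ->
    rnorm (A (r a y)) <= M * N.
  move=> N0 yN; apply: le_trans (AM _) _; rewrite ler_pM2l//.
  by apply: (rnorm_le_co Yco) => // b; rewrite rE.
have /choice[g gE] := fun y => co_blocks Yco (ltW M0) (rA y).
have [||||G [GE GM]] := @exists_co_op (fun y => co (g y)) M.
- move=> a x y n; have [c [d ->]] := blk_surj n.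
  rewrite !gE -(co_linear Yco) -linearP; congr (co (A _) d).
  by apply: co_ext => b; rewrite (co_linear Yco) !rE (co_linear Yco).
- by move=> y; exists (g y).
- exact: ltW.
- move=> y n; have [a [b ->]] := blk_surj n; rewrite gE.
  apply: le_trans (rnorm_co_le Yco _ _) _; apply: rA; first exact: rnorm_ge0.
  by move=> c; exact: (rnorm_co_le Yco).
exists G; split=> [|a r' r'E y]; first by exists M.
have r'r z : r' z = r a z by apply: co_ext => b; rewrite r'E rE.
by rewrite !r'r; apply: co_ext => b; rewrite rE GE gE.
Qed.

(** Pelczynski's decomposition method.  The even and the odd positions give
    [Y = Y + Y], and amplifying a projection [P] gives [Y = Y + P Y]; so when
    [Y] is isomorphic to a complemented subspace of [P Y], the space [P Y] is
    isomorphic to [Y]. *)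
Lemma pelczynski_decomposition (P V U : {linear Y -> Y}) :
    bounded_op P -> (forall y, P (P y) = P y) ->
    bounded_op V -> bounded_op U -> (forall y, U (P (V y)) = y) ->
  isomorphic (range_space P) Y.
Proof.
move=> bP PP bV bU UPV.
have [S0 [S0E bS0]] := exists_spread false.
have [S1 [S1E bS1]] := exists_spread true.
have [|r0 [r0E br0]] := @exists_reindex (blk 0).
  exact: (leq_tends_to_infinity tends_to_infinity_id (leq_blkr 0)).
have [|r1 [r1E br1]] := @exists_reindex (fun n => n.*2.+1).
  apply: (leq_tends_to_infinity tends_to_infinity_id) => n.
  by rewrite leqW// -addnn leq_addr.
have [PA [bPA PAE]] := exists_amplification bP.
have r0S0 y : r0 (S0 y) = y.
  by apply: co_ext => n; rewrite r0E S0E /= odd_double doubleK.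
have r1S1 y : r1 (S1 y) = y.
  by apply: co_ext => n; rewrite r1E S1E /= odd_double /= uphalf_double.
have r0S1 y : r0 (S1 y) = 0.
  by apply: co_ext => n; rewrite r0E S1E /= odd_double co0.
have r1S0 y : r1 (S0 y) = 0.
  by apply: co_ext => n; rewrite r1E S0E /= odd_double co0.
have Ssum y : S0 (r0 y) + S1 (r1 y) = y.
  apply: co_ext => n; rewrite coD S0E S1E r0E r1E /=.
  have := odd_double_half n; case: odd => /= {2}<-; by rewrite ?addr0 ?add0r.
have r_ext x y : r0 x = r0 y -> r1 x = r1 y -> x = y.
  by move=> e0 e1; rewrite -[x]Ssum e0 e1 Ssum.
have r0PA y : r0 (PA y) = P (r0 y) by apply: PAE => z b; rewrite r0E.
have /choice[r rP] : forall a, exists G : {linear Y -> Y},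
    forall y b, co (G y) b = co y (blk a b).
  move=> a; have [|G [GE _]] := @exists_reindex (blk a); last by exists G.
  exact: (leq_tends_to_infinity tends_to_infinity_id (leq_blkr a)).
have blk_ext x y : (forall a, r a x = r a y) -> x = y.
  move=> xy; apply: co_ext => n; have [a [b ->]] := blk_surj n.
  by rewrite -!rP xy.
have rr1 a y : r a (r1 y) = r a.+1 y.
  by apply: co_ext => b; rewrite !rP r1E.
have rPA a y : r a (PA y) = P (r a y) by exact/PAE/rP.
have r1PA y : r1 (PA y) = PA (r1 y).
  by apply: blk_ext => a; rewrite rr1 !rPA rr1.
have PAPA y : PA (PA y) = PA y by apply: blk_ext => a; rewrite !rPA PP.
have PAS1 y : PA (S1 y) = S1 (PA y).
  by apply: r_ext; rewrite ?r0PA ?r1PA ?r0S1 ?r1S1 ?linear0.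
have PAS0 y : PA (S0 y) = S0 (P y).
  by apply: r_ext; rewrite ?r0PA ?r1PA ?r0S0 ?r1S0 ?linear0.
pose al y := P (V y); pose be y := U (P y).
have beal y : be (al y) = y by rewrite /be /al PP UPV.
have Pal y : P (al y) = al y by rewrite /al PP.
have alD x y : al (x + y) = al x + al y by rewrite /al !linearD.
have beD x y : be (x + y) = be x + be y by rewrite /be !linearD.
have beB x y : be (x - y) = be x - be y by rewrite /be !linearB.
(* [u, h |-> Phi u h] is the isomorphism of [Y + P Y] onto [Y]: it shifts the
   [P]-parts of the blocks of [u] by one block and inserts [h]. *)
pose Phi u h := (u - PA u) + S1 (PA u) + S0 h.
pose phi1 y := (y - PA y) + PA (r1 y).
pose phi2 y := P (r0 y).
have Phi_phi y : Phi (phi1 y) (phi2 y) = y.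
  have PAphi : PA (phi1 y) = PA (r1 y).
    by rewrite /phi1 linearD linearB /= !PAPA subrr add0r.
  rewrite /Phi PAphi /phi1 /phi2 addrK -PAS1 -PAS0 -addrA -linearD /=.
  by rewrite [S1 _ + _]addrC Ssum subrK.
have phi1Phi u h : P h = h -> phi1 (Phi u h) = u.
  move=> Ph.
  have PAPhi : PA (Phi u h) = S1 (PA u) + S0 h.
    by rewrite /Phi !linearD linearN /= PAPA subrr add0r PAS1 PAPA PAS0 Ph.
  have r1Phi : r1 (Phi u h) = r1 u - PA (r1 u) + PA u.
    by rewrite /Phi !linearD linearN /= r1PA r1S1 r1S0 addr0.
  rewrite /phi1 PAPhi r1Phi !(linearD PA) linearN /= !PAPA subrr add0r.
  by rewrite /Phi -(addrA (u - PA u)) addrK subrK.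
have phi2Phi u h : P h = h -> phi2 (Phi u h) = h.
  move=> Ph.
  have r0Phi : r0 (Phi u h) = r0 u - P (r0 u) + h.
    by rewrite /Phi !(linearD r0) linearN /= r0S1 r0S0 r0PA addr0.
  by rewrite /phi2 r0Phi !(linearD P) linearN /= PP Ph subrr add0r.
(* With [al : Y -> P Y] and its left inverse [be], [P Y = Y + ker be].  [Ff]
   splits off the odd half of [be g], adds it to the component in [ker be] to
   form an element of [P Y], and recombines this with the even half by [Phi]. *)
pose Ff g := Phi (r0 (be g)) (al (r1 (be g)) + (g - al (be g))).
pose Hf y := al (S0 (phi1 y) + S1 (be (phi2 y))) + (phi2 y - al (be (phi2 y))).
have PHf y : P (Hf y) = Hf y.
  by rewrite /Hf linearD linearB /= !Pal /phi2 PP.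
have FHf y : Ff (Hf y) = y.
  have beH : be (Hf y) = S0 (phi1 y) + S1 (be (phi2 y)).
    by rewrite /Hf beD beB !beal subrr addr0.
  have -> : Ff (Hf y) = Phi (phi1 y) (al (be (phi2 y)) + (Hf y - al (be (Hf y)))).
    by rewrite /Ff beH (linearD r0) (linearD r1) /= r0S0 r0S1 r1S0 r1S1 addr0 add0r.
  by rewrite beH {1}/Hf [X in _ + (X - _)]addrC addrK subrKC Phi_phi.
have HFf g : P g = g -> Hf (Ff g) = g.
  move=> Pg; have Ph : P (al (r1 (be g)) + (g - al (be g))) =
      al (r1 (be g)) + (g - al (be g)) by rewrite linearD linearB /= !Pal Pg.
  rewrite /Hf /Ff phi1Phi// phi2Phi// beD beB !beal subrr addr0 Ssum.
  by rewrite [X in _ + X]addrC addKr subrKC.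
pose beL : {linear Y -> Y} := U \o P.
pose alL : {linear Y -> Y} := P \o V.
pose idPA : {linear Y -> Y} := idfun \- PA.
pose idab : {linear Y -> Y} := idfun \- (alL \o beL).
pose phi2L : {linear Y -> Y} := P \o r0.
pose F : {linear Y -> Y} := ((idPA \+ (S1 \o PA)) \o (r0 \o beL)) \+
  (S0 \o ((alL \o (r1 \o beL)) \+ idab)).
pose H : {linear Y -> Y} := (alL \o ((S0 \o (idPA \+ (PA \o r1))) \+
  (S1 \o (beL \o phi2L)))) \+ (idab \o phi2L).
have bbe : bounded_op beL by exact: bounded_op_comp.
have bal : bounded_op alL by exact: bounded_op_comp.
have bidPA : bounded_op idPA.
  by apply: bounded_opD (bounded_opN bPA); exact: bounded_op_id.
have bidab : bounded_op idab.
  apply: bounded_opD (bounded_opN (bounded_op_comp bal bbe)).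
  exact: bounded_op_id.
have bphi2 : bounded_op phi2L by exact: bounded_op_comp.
have bF : bounded_op F.
  apply: bounded_opD (bounded_op_comp bS0 (bounded_opD
    (bounded_op_comp bal (bounded_op_comp br1 bbe)) bidab)).
  exact: bounded_op_comp (bounded_opD bidPA (bounded_op_comp bS1 bPA))
    (bounded_op_comp br0 bbe).
have bH : bounded_op H.
  apply: bounded_opD (bounded_op_comp bidab bphi2).
  apply: bounded_op_comp bal (bounded_opD (bounded_op_comp bS0 _)
    (bounded_op_comp bS1 (bounded_op_comp bbe bphi2))).
  exact: bounded_opD bidPA (bounded_op_comp bPA br1).
have FE y : F y = Ff y by [].
have HE y : H y = Hf y by [].
have Hran y : H y \in submod_pred (range_submod_closed P).
  by apply/mem_set; exists (H y) => //; rewrite HE PHf.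
have ranP (g : range_space P) : P (submod_val g) = submod_val g.
  by case: g => g /= /set_mem[y _ <-].
have [f fE] : exists f : {linear range_space P -> Y},
    forall g, f g = F (submod_val g).
  by apply: exists_linear => a x y; exact: (linearP F).
have [g gE] : exists g : {linear Y -> range_space P},
    forall y, g y = Submod (Hran y).
  by apply: exists_linear => a x y; apply: val_inj; exact: (linearP H).
exists f, g; split.
- apply: bounded_op_continuous; have [M FM] := bF.
  by exists M => x; rewrite fE; exact: FM.
- apply: bounded_op_continuous; have [M HM] := bH.
  by exists M => x; rewrite gE; exact: HM.
- move=> x; apply: val_inj; rewrite gE -[LHS]/(H (f x)) fE.
  by rewrite HE FE HFf// ranP.
- by move=> y; rewrite fE gE -[submod_val _]/(H y) HE FE FHf.
Qed.

(** A factorisation of the identity of [Y] through a projection makes [Y] a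
    complemented subspace of its range. *)
Lemma PFP_primary (C : R) : PFP C Y -> primary Y.
Proof.
move=> YC P bP PP.
case: (YC P bP) => -[V [U [bV bU UPV _]]]; [left|right].
  exact: (pelczynski_decomposition bP PP bV bU UPV).
apply: (pelczynski_decomposition _ _ bV bU UPV) => [|y /=].
  by apply: bounded_opD (bounded_opN bP); exact: bounded_op_id.
by rewrite linearB /= PP subrr subr0.
Qed.

End coordinates.

(** * Rosenthal's lemma and transfer of the factorisation property *)

(** Rosenthal's disjointness lemma.  If no [i] admits [N] pairwise disjoint big
    sets, then along a suitable infinite set of indices, enumerated by [mu], the
    set of all the other indices is never big. *)
Lemma rosenthal_disjointness (big : nat -> set nat -> Prop) (N : nat) :
    (forall i (A : nat -> set nat),
      (forall r, (r < N)%N -> big i (A r)) ->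
      (forall r t n, (r < N)%N -> (t < N)%N -> A r n -> A t n -> r = t) -> False) ->
  exists2 mu : nat -> nat, injective mu &
    forall k, ~ big (mu k) [set mu l | l in [set l | l <> k]].
Proof.
move=> nobig; apply: contrapT => nogood.
have {}nogood (mu : nat -> nat) : injective mu ->
    exists k, big (mu k) [set mu l | l in [set l | l <> k]].
  move=> muI; apply: contrapT => nomu; apply: nogood; exists mu => // k bk.
  by apply: nomu; exists k.
(* Within an infinite set whose members carry [r] disjoint big sets, each of
   infinitely many disjoint infinite pieces has a member for which the rest of
   the piece is big. *)
have step r : exists2 e : nat -> nat, injective e & forall k,
    exists A : nat -> set nat, [/\ forall t, (t < r)%N -> big (e k) (A t),
      forall t u n, (t < r)%N -> (u < r)%N -> A t n -> A u n -> t = u &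
      forall t l, (t < r)%N -> ~ A t (e l)].
  elim: r => [|r [e eI eA]]; first by exists id => // k; exists (fun=> set0).
  have pieceI a : injective (fun b => e (blk a b)).
    by move=> b b' /eI/blk_inj[].
  have /choice[l lP] := fun a => nogood _ (pieceI a).
  exists (fun a => e (blk a (l a))) => [a a' /eI/blk_inj[]//|k].
  have [A [Abig Adisj Ae]] := eA (blk k (l k)).
  exists (fun t => if (t < r)%N then A t
    else [set e (blk k b) | b in [set b | b <> l k]]); split.
  - by move=> t _; case: ifP => [/Abig//|_]; exact: lP.
  - move=> t u n; rewrite !ltnS => tr ur; case: ifP => tr'; case: ifP => ur'.
    + exact: Adisj.
    + by move=> + [b _ bn]; rewrite -bn => /(Ae _ _ tr').
    + by move=> [b _ <-] /(Ae _ _ ur').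
    + move/negbT: tr'; move/negbT: ur'; rewrite -!leqNgt => ru rt _ _.
      by apply/eqP; rewrite eqn_leq (leq_trans tr) ?(leq_trans ur).
  - move=> t m _; case: ifP => [tr|_]; first exact: Ae.
    by move=> [b /= bk /eI/blk_inj[km bl]]; apply: bk; rewrite bl km.
have [e _ eA] := step N.
by have [A [Abig Adisj _]] := eA 0%N; exact: (nobig (e 0%N) A).
Qed.

Lemma infinite_pigeonhole (P Q : nat -> Prop) : (forall n, P n \/ Q n) ->
  exists2 nu : nat -> nat, injective nu &
    (forall k, P (nu k)) \/ (forall k, Q (nu k)).
Proof.
move=> PQ; have [[N NQ]|/forallNP PI] := pselect (exists N, forall n, (N <= n)%N -> Q n).
  exists (addn N); first by move=> x y /addnI.
  by right=> k; apply: NQ; exact: leq_addr.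
have /choice[f fP] : forall n, exists m, (n <= m)%N /\ P m.
  move=> n; apply: contrapT => /forallNP nP; refine (PI n _) => m nm.
  by have [Pm|//] := PQ m; case: (nP m (conj nm Pm)).
pose nu := fix nu k := if k is k'.+1 then f (nu k').+1 else f 0%N.
have nuS k : (nu k < nu k.+1)%N by have [] := fP (nu k).+1.
have nu_lt i j : (i < j)%N -> (nu i < nu j)%N.
  elim: j => // j IH; rewrite ltnS leq_eqVlt => /predU1P[->//|/IH ij].
  exact: ltn_trans (nuS j).
exists nu; last by left=> -[|k]; [exact: (fP 0%N).2|exact: (fP (nu k).+1).2].
move=> i j; case: (ltngtP i j) => // /nu_lt; first by move=> + e; rewrite e ltnn.
by move=> + e; rewrite e ltnn.
Qed.

Section transfer.
Context {R : realType} {s : scalars}.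
Local Notation K := (scalar_field R s).

(** The common consequence of the two hypotheses on [X]: there are copies [J m] of
    [X] in itself, uniformly complemented by [Q m], such that a long sequence [z]
    whose signed sums are bounded by [M] has an entry [z r] almost annihilated by
    [Q r].  The copies may coincide. *)
Definition has_sign_small_copies (X : normedModType K) : Prop :=
  exists (J Q : nat -> {linear X -> X}) (a b : R),
  [/\ 0 <= a, 0 <= b, forall m x, rnorm (J m x) <= a * rnorm x,
      forall m x, rnorm (Q m x) <= b * rnorm x & forall m x, Q m (J m x) = x] /\
  forall M e : R, 0 < e -> exists N, forall z : nat -> X,
    (forall sg : {ffun 'I_N -> bool},
      rnorm (\sum_(i < N) (-1) ^+ sg i *: z i) <= M) ->
    exists2 r, (r < N)%N & rnorm (Q r (z r)) <= e.

Context {X : normedModType K} {Y : completeNormedModType K}.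
Context {co : Y -> nat -> X}.
Hypothesis Yco : sup_sequence_space co.

(** Compress the matrix of [S] to the rows and columns indexed by [mu].  If [q k]
    and [j k] turn its diagonal entries into the identity, and if its rows,
    followed by [q k], have norm at most [d] off the diagonal, then for [d * a]
    at most 1/2 a diagonal compression of [S] lies within 1/2 of the identity. *)
Lemma almost_diagonal_factors (S : {linear Y -> Y}) (mu : nat -> nat)
    (j q : nat -> {linear X -> X}) (a c d : R) :
    bounded_op S -> injective mu -> 0 <= a -> 0 <= c -> 0 <= d -> d * a <= 2^-1 ->
    (forall k x, rnorm (j k x) <= a * rnorm x) ->
    (forall k x, rnorm (q k x) <= c * rnorm x) ->
    (forall k x y, co y (mu k) = j k x -> (forall n, n <> mu k -> co y n = 0) ->
      q k (co (S y) (mu k)) = x) ->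
    (forall k y, (forall n, ~ [set mu l | l in [set l | l <> k]] n -> co y n = 0) ->
      rnorm (q k (co (S y) (mu k))) <= d * rnorm y) ->
  factors_through (2 * c * a) (idfun : {linear Y -> Y}) S.
Proof.
move=> [t St] muI a0 c0 d0 da ja qc diag offdiag.
have /choice[w wP] : forall n, exists v : option nat,
    if v is Some k then mu k = n else forall k, mu k <> n.
  move=> n; have [[k kn]|nk] := pselect (exists k, mu k = n); first by exists (Some k).
  by exists None => k kn; apply: nk; exists k.
have wmu k : w (mu k) = Some k.
  by have := wP (mu k); case: (w _) => [l /muI ->//|/(_ k)].
pose h n := odflt n (w n).
have hoo : tends_to_infinity h.
  move=> k; exists (maxn k (\max_(i < k) (mu i).+1)) => n.
  rewrite geq_max => /andP[kn mun]; rewrite /h.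
  have := wP n; case: (w n) => [l /= ln|//]; rewrite leqNgt; apply/negP => lk.
  have := leq_trans (@leq_bigmax _ (fun i : 'I_k => (mu i).+1) (Ordinal lk)) mun.
  by rewrite /= ln ltnn.
have [|y n|V [VE Va]] := @exists_co_op_dominated _ _ _ _ _ Yco
    (fun y n => if w n is Some k then j k (co y k) else 0) h a _ hoo a0.
- move=> e x y n; case: (w n) => [k|]; last by rewrite scaler0 addr0.
  by rewrite (co_linear Yco) linearP.
- by rewrite /h; case: (w n) => [k|] //=; rewrite rnorm0 mulr_ge0 ?rnorm_ge0.
have Vmu y k : co (V y) (mu k) = j k (co y k) by rewrite VE wmu.
have [||y n|U [UE Uc]] := @exists_co_op_dominated _ _ _ _ _ Yco
    (fun y n => q n (co y (mu n))) mu c _ _ c0.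
- by move=> e x y n; rewrite (co_linear Yco) linearP.
- exact: injective_tends_to_infinity.
- exact: qc.
pose G : {linear Y -> Y} := U \o (S \o V).
have [y|W [WG W2]] := @neumann_left_inverse _ _ _ G.
  apply: (rnorm_le_co Yco) => [|k]; first by rewrite mulr_ge0 ?rnorm_ge0 ?invr_ge0.
  have [y1 y1E] := co_single Yco (mu k) (j k (co y k)).
  have y1k : q k (co (S y1) (mu k)) = co y k.
    apply: diag; first by rewrite y1E eqxx.
    by move=> n /eqP/negPf nk; rewrite y1E nk.
  have -> : co (G y - y) k = q k (co (S (V y - y1)) (mu k)).
    by rewrite (coB Yco) /G /= UE linearB (coB Yco) linearB /= y1k.
  apply: le_trans (offdiag _ _ _) _.
    move=> n nk; rewrite (coB Yco) y1E; case: eqP => [->|nmu].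
      by rewrite Vmu subrr.
    rewrite subr0 VE; have := wP n; case: (w n) => // l ln.
    exfalso; apply: nk; exists l => //= lk; apply: nmu.
    by rewrite -ln lk.
  have Vy1 : rnorm (V y - y1) <= a * rnorm y.
    apply: (rnorm_le_co Yco) => [|n]; first by rewrite mulr_ge0 ?rnorm_ge0.
    rewrite (coB Yco) y1E; case: eqP => [->|_].
      by rewrite Vmu subrr rnorm0 mulr_ge0 ?rnorm_ge0.
    by rewrite subr0 (le_trans (rnorm_co_le Yco _ _)).
  apply: le_trans (ler_wpM2l d0 Vy1) _.
  by rewrite mulrA ler_wpM2r ?rnorm_ge0.
apply: (@factors_through_bounds _ _ a (2 * c) _ S V (W \o U)) => // [|y].
  by rewrite mulr_ge0.
rewrite /= (le_trans (W2 _))// -mulrA ler_wpM2l//.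
Qed.

(** Signed sums of disjointly supported vectors of the unit ball stay in the
    unit ball. *)
Lemma disjoint_sum_le1 (N : nat) (A : nat -> set nat) (x : nat -> Y)
    (sg : 'I_N -> bool) :
    (forall r t n, (r < N)%N -> (t < N)%N -> A r n -> A t n -> r = t) ->
    (forall r, (r < N)%N -> rnorm (x r) <= 1) ->
    (forall r n, (r < N)%N -> ~ A r n -> co (x r) n = 0) ->
  rnorm (\sum_(i < N) (-1) ^+ sg i *: x i) <= 1.
Proof.
move=> Adisj x1 xA; apply: (rnorm_le_co Yco) => // n; rewrite (co_sum Yco).
have [[r rn]|nA] := pselect (exists r : 'I_N, A r n).
  rewrite (bigD1 r)//= big1 ?addr0 => [|i ir].
    by rewrite (coZ Yco) rnorm_signZ (le_trans (rnorm_co_le Yco _ _))// x1.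
  rewrite (coZ Yco) xA ?scaler0// => in_.
  by move/eqP: ir; apply; apply: val_inj; exact: (Adisj _ _ n (ltn_ord i) (ltn_ord r)).
rewrite big1 ?rnorm0// => i _; rewrite (coZ Yco) xA ?scaler0// => in_.
by apply: nA; exists i.
Qed.

(** The new constant depends only on [C] and on the norms of the copies of [X];
    the operator [T] only affects the number [N] of disjoint big sets that has
    to be excluded. *)
Lemma sign_small_copies_PFP (C : R) : 0 <= C -> PFP C X ->
  has_sign_small_copies X -> exists C', PFP C' Y.
Proof.
move=> C0 XC [J [Q [a [b [[a0 b0 Ja Qb QJ] ss]]]]].
exists (2 * (C * b) * a) => T bT; have [t t0 Tt] := bounded_op_gt0 bT.
(* The row errors are multiplied by at most [C * a] below. *)
pose e := (2 * (C * a + 1))^-1.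
have Ca1 : 0 < C * a + 1 by rewrite ltr_wpDl ?mulr_ge0.
have e0 : 0 < e by rewrite invr_gt0 mulr_gt0.
have eCa : C * e * a <= 2^-1.
  rewrite mulrAC /e invfM mulrCA ler_piMr ?invr_ge0// ler_pdivrMr// mul1r.
  by rewrite lerDl.
pose small m i (A : set nat) := forall x : Y, (forall n, ~ A n -> co x n = 0) ->
  rnorm (Q m (co (T x) i)) <= e * rnorm x.
have [N NP] := ss t e e0.
have [|mu muI muP] := @rosenthal_disjointness
    (fun i A => forall m, ~ small m i A) N.
  move=> i A Abig Adisj.
  have /choice[x xP] : forall r, exists x : Y, (r < N)%N ->
      [/\ rnorm x <= 1, forall n, ~ A r n -> co x n = 0 &
          e < rnorm (Q r (co (T x) i))].
    move=> r; have [rN|_] := boolP (r < N)%N; last by exists 0.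
    have /existsNP[x /not_implyP[xA /negP]] := Abig r rN r; rewrite -ltNge => xe.
    have [x0|x0] := eqVneq (rnorm x) 0.
      exfalso; move: xe; rewrite (rnorm0_eq0 x0) linear0 (co0 Yco) linear0.
      by rewrite !rnorm0 mulr0 ltxx.
    have xgt0 : 0 < rnorm x by rewrite lt_def x0 rnorm_ge0.
    exists (of_real s (rnorm x)^-1 *: x); split=> [|n An|].
    - by rewrite rnorm_scale ?invr_ge0 ?rnorm_ge0// mulVf.
    - by rewrite (coZ Yco) xA ?scaler0.
    - rewrite linearZ (coZ Yco) linearZ /= rnorm_scale ?invr_ge0 ?rnorm_ge0//.
      by rewrite mulrC ltr_pdivlMr.
  have [sg|r rN] := NP (fun r => co (T (x r)) i).
    have -> : \sum_(k < N) (-1) ^+ sg k *: co (T (x k)) i =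
        co (T (\sum_(k < N) (-1) ^+ sg k *: x k)) i.
      rewrite linear_sum (co_sum Yco); apply: eq_bigr => k _.
      by rewrite linearZ (coZ Yco).
    rewrite (le_trans (rnorm_co_le Yco _ _))// (le_trans (Tt _))//.
    rewrite ler_piMr ?(ltW t0)//; apply: (@disjoint_sum_le1 N A x sg Adisj) => [k kN|k n kN].
      by have [] := xP k kN.
    by have [_ + _] := xP k kN; apply.
  by have [_ _] := xP r rN; rewrite ltNge => /negP.
have /choice[m mP] : forall k, exists m,
    small m (mu k) [set mu l | l in [set l | l <> k]].
  by move=> k; have /existsNP[m /contrapT] := muP k; exists m.
(* [i n] embeds [X] as the [n]-th coordinate of [Y]. *)
have /choice[i iE] : forall n, exists i : X -> Y, forall x k,
    co (i x) k = if k == n then x else 0.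
  by move=> n; have /choice[f fE] := co_single Yco n; exists f.
have i_unique n x y : co y n = x -> (forall k, k <> n -> co y k = 0) -> y = i n x.
  by move=> yn y0; apply: (co_ext Yco) => k; rewrite iE; case: eqP => [->//|/y0].
have i_norm n x : rnorm (i n x) <= rnorm x.
  apply: (rnorm_le_co Yco) => [|k]; first exact: rnorm_ge0.
  by rewrite iE; case: eqP => _; rewrite ?rnorm0 ?rnorm_ge0.
have /choice[D DE] : forall k, exists D : {linear X -> X}, forall x,
    D x = Q (m k) (co (T (i (mu k) (J (m k) x))) (mu k)).
  move=> k; apply: exists_linear => c x y.
  rewrite -linearP -(co_linear Yco) -linearP; congr (Q _ (co (T _) _)).
  by apply: (co_ext Yco) => n; rewrite (co_linear Yco) !iE;
    case: eqP => _; rewrite ?linearP// scaler0 addr0.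
have bD k : bounded_op (D k).
  exists (b * (t * a)) => x; rewrite DE (le_trans (Qb _ _))// -!mulrA ler_wpM2l//.
  rewrite (le_trans (rnorm_co_le Yco _ _))// (le_trans (Tt _))// ler_pM2l//.
  by rewrite (le_trans (i_norm _ _)).
have [nu nuI nuP] := infinite_pigeonhole (fun k => XC (D k) (bD k)).
have {}muI : injective (mu \o nu) by exact: inj_comp.
have mP' k y : (forall n, ~ [set (mu \o nu) l | l in [set l | l <> k]] n ->
    co y n = 0) ->
    rnorm (Q (m (nu k)) (co (T y) (mu (nu k)))) <= e * rnorm y.
  move=> y0; apply: mP => n nA; apply: y0 => -[l lk ln]; apply: nA.
  by exists (nu l) => //= /nuI.
(* To be applied to [T] and to [I - T], whose diagonals [E] differ and whose
   off-diagonal entries agree up to sign. *)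
have key (S : {linear Y -> Y}) (E : nat -> {linear X -> X}) : bounded_op S ->
    (forall k, factors_through C (idfun : {linear X -> X}) (E k)) ->
    (forall k x, Q (m (nu k)) (co (S (i (mu (nu k)) (J (m (nu k)) x))) (mu (nu k)))
      = E k x) ->
    (forall k y, (forall n, ~ [set (mu \o nu) l | l in [set l | l <> k]] n ->
      co y n = 0) ->
      rnorm (Q (m (nu k)) (co (S y) (mu (nu k)))) <= e * rnorm y) ->
    factors_through (2 * (C * b) * a) (idfun : {linear Y -> Y}) S.
  move=> bS CE SE Se.
  have /choice[V /choice[U UV]] := fun k =>
    factors_through_id_contraction C0 (CE k).
  apply: (@almost_diagonal_factors S (mu \o nu) (fun k => J (m (nu k)) \o V k)
    (fun k => U k \o Q (m (nu k))) a (C * b) (C * e)) => //.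
  - by rewrite mulr_ge0.
  - by rewrite mulr_ge0// ltW.
  - move=> k x /=; have [Vx _ _] := UV k; rewrite (le_trans (Ja _ _))//.
    by rewrite ler_wpM2l.
  - move=> k x /=; have [_ Ux _] := UV k; rewrite (le_trans (Ux _))//.
    by rewrite -mulrA ler_wpM2l.
  - move=> k x y /= yk y0; have [_ _ UEV] := UV k.
    by rewrite (i_unique _ _ _ yk y0) SE.
  - move=> k y y0 /=; have [_ Ux _] := UV k; rewrite (le_trans (Ux _))//.
    by rewrite -mulrA ler_wpM2l//; exact: Se.
case: nuP => nuP; [left|right].
  by apply: (key T (D \o nu)) => // k x; rewrite /= DE.
apply: (key _ (fun k => idfun \- D (nu k))) => // [|k x|k y y0].
- by apply: bounded_opD (bounded_opN bT); exact: bounded_op_id.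
- by rewrite /= (coB Yco) linearB /= iE eqxx QJ DE.
- rewrite /= (coB Yco) y0 ?sub0r => [|[l lk /muI]//].
  by rewrite linearN rnormN; exact: mP'.
Qed.

End transfer.

(** * Finite cotype and l_p-sums *)

Section sign_small.
Context {R : realType} {s : scalars}.
Local Notation K := (scalar_field R s).

Lemma card_signs (n : nat) : #|{ffun 'I_n -> bool}| = (2 ^ n)%N.
Proof. by rewrite card_ffun card_bool card_ord. Qed.

Lemma exists_natmul_gt (A b : R) : 0 < b -> exists N : nat, A < N%:R * b.
Proof.
move=> b0; exists (Num.truncn (A / b)).+1.
by rewrite -ltr_pdivrMr//; exact: truncnS_gt.
Qed.

(** Cotype [q] bounds [N e^q] by [(C M)^q] when [N] vectors of norm at least [e]
    have signed sums of norm at most [M]. *)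
Lemma finite_cotype_sign_small_copies (X : normedModType K) :
  finite_cotype X -> has_sign_small_copies X.
Proof.
move=> [q q2 [C cotC]]; have q0 : 0 < q by apply: lt_le_trans q2.
exists (fun=> idfun), (fun=> idfun), 1, 1; split.
  by split=> // m x; rewrite mul1r.
move=> M e e0.
have [N NP] := exists_natmul_gt ((`|C| * `|M|) `^ q) (powR_gt0 q e0).
exists N => z zM; apply: contrapT => ze.
have {}ze (r : 'I_N) : e <= rnorm (z r).
  by rewrite leNgt; apply/negP => /ltW zr; apply: ze; exists r.
have := cotC N (fun i => z i); apply/negP; rewrite -ltNge.
apply: (@le_lt_trans _ _ (`|C| * `|M|)).
  apply: (@le_trans _ _ (`|C| * Num.sqrt ((2 ^+ N)^-1 *
      \sum_(sg : {ffun 'I_N -> bool}) rnorm (\sum_(i < N) (-1) ^+ sg i *: z i) ^+ 2))).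
    by rewrite ler_wpM2r ?sqrtr_ge0// ler_norm.
  rewrite ler_wpM2l// -[leRHS]sqrtr_sqr ler_sqrt ?sqr_ge0//.
  rewrite ler_pdivrMl ?exprn_gt0//.
  apply: (@le_trans _ _ (\sum_(sg : {ffun 'I_N -> bool}) M ^+ 2)).
    by apply: ler_sum => sg _; rewrite lerXn2r ?nnegrE ?rnorm_ge0 ?(le_trans _ (zM sg)) ?rnorm_ge0.
  by rewrite sumr_const card_signs -[leLHS]mulr_natl natrX.
have -> : `|C| * `|M| = ((`|C| * `|M|) `^ q) `^ q^-1.
  by rewrite -powRrM mulfV ?gt_eqF// powRr1// mulr_ge0.
apply: gt0_ltr_powR; rewrite ?invr_gt0// ?nnegrE ?powR_ge0//.
  by apply: sumr_ge0 => i _; exact: powR_ge0.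
apply: lt_le_trans NP _.
rewrite -[N in N%:R]card_ord mulr_natl -sumr_const; apply: ler_sum => i _.
by rewrite ge0_ler_powR ?nnegrE ?(ltW q0) ?(ltW e0) ?rnorm_ge0.
Qed.

Section ell_p.
Context (p : R) (p1 : (1 <= p%:E)%E).

Let p_gt0 : 0 < p.
Proof. by move: p1; rewrite lee_fin; apply: lt_le_trans. Qed.

Lemma exists_ell_single (X : normedModType K) (m : nat) (x : X) :
  exists y : ell p1 X, (forall n, y n = if n == m then x else 0) /\
    rnorm y <= rnorm x.
Proof.
pose g n : X := if n == m then x else 0.
have lg : lnorm p%:E (fun k => rnorm (g k)) = (rnorm x)%:E.
  rewrite /lnorm (@nneseriesD1 _ _ m xpredT)//.
  rewrite eseries0 ?adde0 => [|k _ /= /negPf km]; last first.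
    by rewrite /g km rnorm0 normr0 powR0 ?gt_eqF.
  rewrite /g eqxx poweR_EFin -powRrM mulfV ?gt_eqF// powRr1// ger0_norm//.
  exact: rnorm_ge0.
have gE : g \in ell_pred (X := X) p1.
  have lg_fin : (lnorm p%:E (fun k => rnorm (g k)) < +oo)%E by rewrite lg ltry.
  exact: mem_set lg_fin.
exists (Ell gE); split=> //.
rewrite -(@ler_of_real R s) rnormE.
by rewrite -[`|_|]/(of_real s (fine (lnorm p%:E (fun k => rnorm (g k))))) lg.
Qed.

Lemma ell_partial_sum_le (X : normedModType K) (y : ell p1 X) (N : nat) :
  \sum_(r < N) rnorm (y r) `^ p <= rnorm y `^ p.
Proof.
have yE : (rnorm y)%:E = lnorm p%:E (fun k => rnorm (y k)).
  rewrite -[RHS](fineK (ell_fin_num y)); congr _%:E.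
  by apply: (can_inj (@of_realK R s)); rewrite rnormE.
have S0 : (0 <= \sum_(k <oo) (`|rnorm (y k)| `^ p)%:E)%E.
  by rewrite nneseries_ge0// => j _ _; rewrite lee_fin powR_ge0.
have SE : ((rnorm y `^ p)%:E = \sum_(k <oo) (`|rnorm (y k)| `^ p)%:E)%E.
  by rewrite -poweR_EFin yE /lnorm -poweRrM mulVf ?gt_eqF// poweRe1.
rewrite -lee_fin SE -sumEFin (nneseries_split 0 N); last first.
  by move=> j _; rewrite lee_fin powR_ge0.
rewrite add0n -[leLHS]adde0; apply: leeD; last first.
  by rewrite nneseries_ge0// => j _ _; rewrite lee_fin powR_ge0.
rewrite big_mkord; apply: lee_sum => j _.
by rewrite ger0_norm ?rnorm_ge0.
Qed.

(** Change the [r]-th sign. *)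
Definition flip_sign (N : nat) (r : 'I_N) (sg : {ffun 'I_N -> bool}) :
  {ffun 'I_N -> bool} := [ffun i => sg i (+) (i == r)].

Lemma flip_signK N (r : 'I_N) : involutive (flip_sign r).
Proof. by move=> sg; apply/ffunP => i; rewrite !ffunE addbK. Qed.

(** Flipping the [r]-th sign changes a signed sum by [2 z_r], so one of the two
    sums is at least as large as [z_r] under any linear map. *)
Lemma flip_sign_large (X Z : normedModType K) (Q : {linear X -> Z}) (N : nat)
    (z : 'I_N -> X) (r : 'I_N) (sg : {ffun 'I_N -> bool}) (e : R) :
    0 <= e -> e <= rnorm (Q (z r)) ->
  e `^ p <= rnorm (Q (\sum_i (-1) ^+ sg i *: z i)) `^ p +
    rnorm (Q (\sum_i (-1) ^+ (flip_sign r sg) i *: z i)) `^ p.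
Proof.
move=> e0 ez.
set x := \sum_i _ *: _; set x' := \sum_i _ *: _.
pose w := (-1) ^+ sg r *: z r.
have xx' : x - x' = of_real s 2 *: w.
  rewrite (_ : 2 = 1 + 1)// of_realD of_real1 scalerDl scale1r.
  rewrite /x /x' [X in X - _](bigD1 r)//= [X in _ - X](bigD1 r)//= !ffunE eqxx addbT.
  have -> : \sum_(i | i != r) (-1) ^+ flip_sign r sg i *: z i =
      \sum_(i | i != r) (-1) ^+ sg i *: z i.
    by apply: eq_bigr => i ir; rewrite /flip_sign ffunE (negPf ir) addbF.
  by rewrite opprD addrACA subrr addr0 signrN scaleNr opprK.
have big : e + e <= rnorm (Q x) + rnorm (Q x').
  have : rnorm (Q x - Q x') <= rnorm (Q x) + rnorm (Q x').
    by rewrite -[X in _ <= _ + X]rnormN; exact: ler_rnormD.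
  apply: le_trans; rewrite -linearB xx' linearZ /= rnorm_scale//.
  by rewrite /w linearZ /= rnorm_signZ; lra.
have le_pow (a : R) : e <= a -> e `^ p <= a `^ p.
  by move=> ea; rewrite ge0_ler_powR ?nnegrE ?(ltW p_gt0)// (le_trans e0).
have [ex|xe] := leP e (rnorm (Q x)).
  by rewrite (le_trans (le_pow _ ex))// lerDl powR_ge0.
have ex' : e <= rnorm (Q x') by lra.
by rewrite (le_trans (le_pow _ ex'))// lerDr powR_ge0.
Qed.

(** [S] below is the sum over all signs of the p-th powers of the norms of the
    coordinates.  Each signed sum contributes at most [(F M)^p], and pairing each
    choice of signs with its [r]-th flip shows that the [r]-th coordinate
    contributes at least [2^N e^p / 2]. *)
Lemma ell_isomorphic_sign_small_copies (X : normedModType K) :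
  isomorphic X (ell p1 X) -> has_sign_small_copies X.
Proof.
move=> [f [g [/continuous_bounded_op bf /continuous_bounded_op bg fK gK]]].
have [F F0 fF] := bounded_op_gt0 bf; have [G G0 gG] := bounded_op_gt0 bg.
have /choice[d dP] : forall m, exists d : X -> ell p1 X, forall x,
    (forall n, d x n = if n == m then x else 0) /\ rnorm (d x) <= rnorm x.
  by move=> m; have /choice[d dP] := @exists_ell_single X m; exists d.
have dE m x n : d m x n = if n == m then x else 0 by have [->] := dP m x.
have dle m x : rnorm (d m x) <= rnorm x by have [] := dP m x.
have /choice[J JE] : forall m, exists J : {linear X -> X}, forall x, J x = g (d m x).
  move=> m; apply: exists_linear => a x y; rewrite -linearP; congr (g _).
  apply: val_inj; apply/funext => n; rewrite -[RHS]/(a *: d m x n + d m y n).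
  rewrite -[LHS]/(d m (a *: x + y) n) !dE.
  by case: eqP => _ //; rewrite scaler0 addr0.
have /choice[Q QE] : forall m, exists Q : {linear X -> X}, forall x, Q x = f x m.
  by move=> m; apply: exists_linear => a x y; rewrite linearP.
exists J, Q, G, F; split.
  split=> [||m x|m x|m x]; try exact: ltW.
  - by rewrite JE (le_trans (gG _))// ler_pM2l.
  - rewrite QE (le_trans _ (fF x))// -(@ler_of_real R s) !rnormE.
    exact: ell_norm_coord.
  - by rewrite QE JE gK dE eqxx.
move=> M e e0.
have [N NP] := exists_natmul_gt (2 * (F * `|M|) `^ p) (powR_gt0 p e0).
exists N => z zM; apply: contrapT => ze.
have {}ze (r : 'I_N) : e <= rnorm (Q r (z r)).
  by rewrite leNgt; apply/negP => /ltW zr; apply: ze; exists r.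
pose x (sg : {ffun 'I_N -> bool}) := \sum_i (-1) ^+ sg i *: z i.
pose S := \sum_(sg : {ffun 'I_N -> bool}) \sum_(r < N) rnorm (Q r (x sg)) `^ p.
have Sle : S <= (2 ^ N)%:R * (F * `|M|) `^ p.
  rewrite -card_signs mulr_natl -sumr_const; apply: ler_sum => sg _.
  under eq_bigr do rewrite QE.
  apply: le_trans (ell_partial_sum_le _ _) _.
  rewrite ge0_ler_powR ?nnegrE ?(ltW p_gt0) ?rnorm_ge0 ?mulr_ge0 ?(ltW F0)//.
  apply: le_trans (fF _) _; rewrite ler_pM2l//.
  by apply: le_trans (zM sg) _; exact: ler_norm.
have Sge : (2 ^ N)%:R * (N%:R * e `^ p) <= 2 * S.
  rewrite /S exchange_big /= mulr_sumr.
  rewrite -[N in N%:R * e `^ p]card_ord [X in _ * X]mulr_natl -sumr_const mulr_sumr.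
  apply: ler_sum => r _.
  rewrite -card_signs mulr_natl -sumr_const.
  rewrite (_ : 2 = 1 + 1 :> R)// mulrDl mul1r.
  rewrite [X in _ + X](reindex_inj (inv_inj (flip_signK r))) -big_split /=.
  by apply: ler_sum => sg _; apply: flip_sign_large => //; exact: ltW.
have : (2 ^ N)%:R * (N%:R * e `^ p) <= (2 ^ N)%:R * (2 * (F * `|M|) `^ p).
  by apply: le_trans Sge _; rewrite mulrCA ler_pM2l.
by rewrite ler_pM2l ?ltr0n ?expn_gt0// leNgt NP.
Qed.

End ell_p.
End sign_small.

(** * The factorisation property and primarity of c_0(X) and l_oo(X) *)

Lemma sup_sequence_space_UPFP_primary (R : realType) (s : scalars)
    (X : normedModType (scalar_field R s))
    (Y : completeNormedModType (scalar_field R s)) (co : Y -> nat -> X) :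
    sup_sequence_space co -> UPFP X -> has_sign_small_copies X ->
  UPFP Y /\ primary Y.
Proof.
move=> Yco [C C1 XC] ss.
have C0 : 0 <= C by exact: le_trans C1.
have [C' YC'] := sign_small_copies_PFP Yco C0 XC ss.
split; last exact: (PFP_primary Yco YC').
exists (Num.max 1 C'); first by rewrite le_max lexx.
have weaken (T : {linear Y -> Y}) :
    factors_through C' (idfun : {linear Y -> Y}) T ->
    factors_through (Num.max 1 C') (idfun : {linear Y -> Y}) T.
  move=> [V [U [bV bU UTV UV]]]; exists V, U; split=> //.
  by rewrite le_max UV orbT.
by move=> T bT; case: (YC' T bT) => /weaken; [left|right].
Qed.

Theorem theorem1p2 (R : realType) (s : scalars)
    (X : completeNormedModType (scalar_field R s))
    (UPFP_X : UPFP X)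
    (i_or_ii : (exists (p : R) (p1 : (1 <= p%:E)%E), isomorphic X (ell p1 X))
               \/ finite_cotype X) :
  (UPFP (c0 X) /\ UPFP (ell_infty X)) /\
  (primary (c0 X) /\ primary (ell_infty X)).
Proof.
have ss : has_sign_small_copies X.
  case: i_or_ii => [[p [p1]]|]; first exact: ell_isomorphic_sign_small_copies.
  exact: finite_cotype_sign_small_copies.
have [cU cP] := sup_sequence_space_UPFP_primary
  (c0_sup_sequence_space X) UPFP_X ss.
have [lU lP] := sup_sequence_space_UPFP_primary
  (ell_infty_sup_sequence_space X) UPFP_X ss.
by [].
Qed.
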